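(* Let $\mathcal{A}=(A_1,\dots,A_k)$, where each $A_i=\{a_{i,1},\dots,a_{i,m_i}\}$ is a multi-subset of $\mathbb{Z}^n$ with $m_i\ge 2$. The tropical resultant $\mathcal{TR}(\mathcal{A})$ is (the support of) a subfan of the secondary fan of the Cayley configuration $\mathrm{Cay}(A_1,\dots,A_k)$, namely the subfan consisting of the cones whose corresponding mixed subdivision of $\sum_{i=1}^kA_i$ contains a fully mixed cell.
   Context: Points in configurations are labeled and need not be distinct. Let $m=\sum m_i$. Tropical resultant: a tropical polynomial with support $A_i$ is $F_i(x)=\min_j(c_{ij}+a_{ij}\cdot x)$, $(c_{ij})_j\in\mathbb{R}^{A_i}=\mathbb{R}^{m_i}$; $\mathcal{T}(F_i)\subseteq\mathbb{R}^n$ is the set of $x$ at which the minimum is attained by at least two indices $j$. $\mathcal{TR}(\mathcal{A})\subseteq\mathbb{R}^m=\prod_i\mathbb{R}^{A_i}$ is the set of tuples $(F_1,\dots,F_k)$ with $\bigcap_i\mathcal{T}(F_i)\ne\emptyset$. $\mathrm{Cay}(\mathcal{A})=\bigcup_i\{e_i\}\times A_i\subset\mathbb{Z}^k\times\mathbb{Z}^n$. Regular subdivisions: for a point configuration $A\subset\mathbb{R}^d$ and a weight vector $\omega\in\mathbb{R}^A$, the regular subdivision $\Delta_\omega$ induced by $\omega$ has maximal cells $\{a\in A:(a,\omega(a))\in F\}$ for $F$ ranging over the bounded facets of $\mathrm{conv}\{(a,\omega(a))\}+\mathbb{R}_{\ge0}e_{d+1}$ (relative to the affine span of $A$); if $F'$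 is a face of the convex hull of a maximal cell $C$, then $C\cap F'$ is a cell. The secondary fan of $A$ is the fan in $\mathbb{R}^A$ whose cones are the closures of the sets of weight vectors inducing the same regular subdivision; each cone corresponds to the subdivision induced by its relative interior points. Mixed subdivisions: $\sum_iA_i$ is the configuration of points $a_{1,j_1}+\cdots+a_{k,j_k}$ labeled by $[m_1]\times\cdots\times[m_k]$. A mixed cell is a product of labels $J_1\times\cdots\times J_k$ with all $J_i\subseteq[m_i]$ nonempty; it is fully mixed if $|J_i|\ge2$ for all $i$. A subdivision is mixed if all its maximal cells are labeled by mixed cells. For a subdivision $\Delta$ of $\mathrm{Cay}(\mathcal{A})$, the corresponding mixed subdivision consists of the cells $\sum_iC_i$, $C_i\subseteq A_i$, such that $\bigcup_i C_i$ (viewed in $\mathrm{Cay}(\mathcal{A})$) is a maximal cell of $\Delta$. This is a bijection between regular subdivisions of $\mathrm{Cay}(\mathcal{A})$ and regular mixed subdivisions of $\sum_iA_i$. *)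

(* Defs.v *)
From HB Require Import structures.
From mathcomp Require Import all_boot all_order all_algebra.
From mathcomp Require Import all_classical all_reals all_analysis.

Set Implicit Arguments.
Unset Strict Implicit.
Unset Printing Implicit Defensive.

Import Order.TTheory GRing.Theory Num.Theory.
Import numFieldNormedType.Exports.

(* Function spaces [L -> R^o] carry the product topology. *)
Export ArrowAsProduct.

Local Open Scope classical_set_scope.
Local Open Scope ring_scope.

Section ConvexGeometry.
Variables (R : realType) (V : lmodType R).
Implicit Types (S P F : set V) (Sigma : set (set V)).

Definition conv_hull S : set V :=
  [set x | exists (N : nat) (p : 'I_N -> V) (t : 'I_N -> R),
    [/\ forall i, S (p i), forall i, 0 <= t i, \sum_i t i = 1
      & x = \sum_i t i *: p i]].

Definition aff_hull S : set V :=
  [set x | exists (N : nat) (p : 'I_N -> V) (t : 'I_N -> R),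
    [/\ forall i, S (p i), \sum_i t i = 1 & x = \sum_i t i *: p i]].

(* The nonempty faces of [P], including [P] itself. *)
Definition face P F : Prop :=
  F !=set0 /\
  exists f : {scalar V}, F = [set x | P x /\ forall y, P y -> f x <= f y].

Definition polyhedral_cone P : Prop :=
  exists (N : nat) (u : 'I_N -> {scalar V}), P = [set x | forall i, 0 <= u i x].

Definition fan Sigma : Prop :=
  [/\ finite_set Sigma,
      forall C, Sigma C -> polyhedral_cone C,
      forall C F, Sigma C -> face C F -> Sigma F
    & forall C D, Sigma C -> Sigma D ->
        face C (C `&` D) /\ face D (C `&` D)].

Definition subfan Sigma' Sigma : Prop := Sigma' `<=` Sigma /\ fan Sigma'.

Definition fan_support Sigma : set V := \bigcup_(C in Sigma) C.

End ConvexGeometry.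

Definition has_aff_dim (R : realType) (V : vectType R) (S : set V) (d : nat) :=
  exists (x0 : V) (U : {vspace V}),
    \dim U = d /\ aff_hull S = [set x | x - x0 \in U].

Definition facet (R : realType) (V : vectType R) (P F : set V) : Prop :=
  face P F /\ exists d, has_aff_dim P d.+1 /\ has_aff_dim F d.

Definition relint (R : realType) (L : finType) (S : set (L -> R^o)) :
    set (L -> R^o) :=
  [set x | S x /\ \forall y \near x, aff_hull S y -> S y].

(* A point configuration is a family [a] of points indexed by a finite type [L]
   of labels, possibly with repetitions; cells are sets of labels. *)
Section RegularSubdivisions.
Variables (R : realType) (d : nat) (L : finType) (a : L -> 'rV[R]_d).
Implicit Types (w : L -> R^o) (C D : {set L}) (Delta : set {set L}).

Definition lifted_polyhedron w : set ('rV[R]_d * R^o) :=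
  [set p | exists2 q : 'rV[R]_d * R^o,
    conv_hull (range (fun l => (a l, w l) : 'rV[R]_d * R^o)) q
    & p.1 = q.1 /\ q.2 <= p.2].

Definition facet_cell w C : Prop :=
  exists F : set ('rV[R]_d * R^o),
    [/\ facet (lifted_polyhedron w) F, bounded_set F
      & forall l, l \in C <-> F (a l, w l)].

Definition regular_subdivision w : set {set L} :=
  [set D | exists C (F : set 'rV[R]_d),
    [/\ facet_cell w C, face (conv_hull (a @` [set` C])) F
      & forall l, l \in D <-> l \in C /\ F (a l)]].

Definition maximal_cell Delta C : Prop :=
  Delta C /\ forall D, Delta D -> C \subset D -> D = C.

Definition secondary_cone w : set (L -> R^o) :=
  closure [set w' | regular_subdivision w' = regular_subdivision w].

Definition secondary_fan : set (set (L -> R^o)) := range secondary_cone.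

Definition cone_subdivision (sigma : set (L -> R^o)) Delta : Prop :=
  relint sigma !=set0 /\ forall w, relint sigma w -> regular_subdivision w = Delta.

End RegularSubdivisions.

Section Cayley.
Variables (k n : nat) (m : 'I_k -> nat).
Variable A : forall i : 'I_k, 'I_(m i) -> 'rV[int]_n.

(* The label [Tagged _ j] with tag [i] stands for the point [A i j]; a vector in
   the product of the [R^(m i)] is a function on these labels. *)
Definition label : finType := {i : 'I_k & 'I_(m i)}.

Definition cayley_int (l : label) : 'rV[int]_(k + n) :=
  row_mx (delta_mx 0 (tag l)) (A (tagged l)).

Definition cayley (R : realType) (l : label) : 'rV[R]_(k + n) :=
  map_mx intr (cayley_int l).

Definition mixed_label : finType := {dffun forall i : 'I_k, 'I_(m i)}.

Definition mixed_cell (J : forall i : 'I_k, {set 'I_(m i)}) : {set mixed_label} :=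
  setXn J.

Definition fully_mixed (P : {set mixed_label}) : Prop :=
  exists2 J : forall i : 'I_k, {set 'I_(m i)},
    P = mixed_cell J & forall i, (2 <= #|J i|)%N.

Definition cayley_cell (J : forall i : 'I_k, {set 'I_(m i)}) : {set label} :=
  finset (fun l : label => tagged l \in J (tag l)).

Definition mixed_subdivision (Delta : set {set label}) : set {set mixed_label} :=
  [set P | exists2 J : forall i : 'I_k, {set 'I_(m i)},
    P = mixed_cell J & maximal_cell Delta (cayley_cell J)].

End Cayley.

Section TropicalResultant.
Variables (R : realType) (n : nat).

Definition trop_term (N : nat) (a : 'I_N -> 'rV[int]_n) (c : 'I_N -> R)
    (x : 'rV[R]_n) (j : 'I_N) : R :=
  c j + \sum_(s < n) (a j 0 s)%:~R * x 0 s.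

Definition trop_hypersurface (N : nat) (a : 'I_N -> 'rV[int]_n)
    (c : 'I_N -> R) : set 'rV[R]_n :=
  [set x | exists j1 j2 : 'I_N, j1 != j2 /\
    forall j, trop_term a c x j1 <= trop_term a c x j /\
              trop_term a c x j2 <= trop_term a c x j].

Definition tropical_resultant (k : nat) (m : 'I_k -> nat)
    (A : forall i : 'I_k, 'I_(m i) -> 'rV[int]_n) : set (label m -> R^o) :=
  [set c | \bigcap_(i in [set: 'I_k])
      trop_hypersurface (A i) (fun j => c (Tagged (fun i => 'I_(m i)) j)) !=set0].

End TropicalResultant.

Arguments tropical_resultant R {n k m} A.

Definition fully_mixed_cones (R : realType) (k n : nat) (m : 'I_k -> nat)
    (A : forall i : 'I_k, 'I_(m i) -> 'rV[int]_n) : set (set (label m -> R^o)) :=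
  [set sigma | secondary_fan (cayley A R) sigma /\
    exists2 Delta, cone_subdivision (cayley A R) sigma Delta
      & exists2 P, mixed_subdivision Delta P & fully_mixed P].

Arguments fully_mixed_cones R {k n m} A.

(* Main.v *)
Require Import Defs.
From HB Require Import structures.
From mathcomp Require Import all_boot all_order all_algebra.
From mathcomp Require Import all_classical all_reals all_analysis.

(* Call an affine function on the configuration lower for a weight [w] if it is
   at most [w]; its tight set is the set of labels where equality holds. The
   cells of the regular subdivision of [w] are the nonempty tight sets of lower
   functions, and the maximal cells are the tight sets on which an affine
   function is determined by its values. Say that [w] refines [v] if every tight
   set of [w] lies in a tight set of [v]. Two facts make the weights refined by
   [w] a polyhedral cone sigma(w) whose relative interior consists of the weights
   with the subdivision of [w]: if [x] lies in sigma(w), so does [w - e x] for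
   small [e > 0]; and if [x], [y] lie in sigma(w), then [x + y] refines [x]. The
   second follows by maximizing a positive functional over the lower functions
   of [w]. Hence the faces of sigma(w) are the sigma(v) with [v] in sigma(w), and
   intersections of such cones are of the same form.
   For the Cayley configuration a lower function amounts to a point [x] of R^n
   together with one lower bound for each tropical polynomial evaluated at [x],
   so the resultant consists of the weights having a tight set with two labels
   over every [i], a condition inherited by refined weights. *)

Set Implicit Arguments.
Unset Strict Implicit.
Unset Printing Implicit Defensive.

Import Order.TTheory GRing.Theory Num.Theory.
Import numFieldNormedType.Exports.

Local Open Scope classical_set_scope.
Local Open Scope ring_scope.

(** [T] bounds every ratio [|g i| / s i], so its inverse is a step valid for all indices at once.
    Division by zero gives 0, so indices with [s i = 0] add nothing to the sum; the sign hypothesis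
    covers them. *)
Lemma small_step (R : realFieldType) (I : finType) (s g : I -> R) :
  (forall i, 0 <= s i) -> (forall i, s i = 0 -> g i <= 0) ->
  exists2 e : R, 0 < e & forall i, e * g i <= s i.
Proof.
move=> s0 sg; pose T := 1 + \sum_i `|g i| / s i.
have ti i : `|g i| / s i <= T.
  rewrite /T (bigD1 i) //= addrCA lerDl addr_ge0 // sumr_ge0 // => j _.
  by rewrite divr_ge0.
have T0 : 0 < T.
  by rewrite /T ltr_pwDl // sumr_ge0 // => j _; rewrite divr_ge0.
exists T^-1; first by rewrite invr_gt0.
move=> i; rewrite mulrC ler_pdivrMr //.
have [si0|si0] := eqVneq (s i) 0; first by rewrite si0 mul0r sg.
have sp : 0 < s i by rewrite lt0r si0 s0.
rewrite (le_trans (ler_norm _)) //.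
by have := ti i; rewrite ler_pdivrMr // mulrC.
Qed.

(** * Lower functions, tight sets and refinement, for a linear space [Aff] of functions containing
    the constants *)

Section LowerFunctions.
Variables (R : realType) (L : finType) (Aff : set (L -> R^o)).
Hypothesis affP : forall (t : R) (g h : L -> R^o),
  Aff g -> Aff h -> Aff (t *: g + h).
Hypothesis aff_cst : forall c : R, Aff (cst c).
Implicit Types (w x y g h : L -> R^o) (C D : {set L}).

Definition lower w h := Aff h /\ forall l, h l <= w l.

Definition tight w h : {set L} := finset (fun l => h l == w l).

Definition spanning C :=
  forall h, Aff h -> (forall l, l \in C -> h l = 0) -> forall l, h l = 0.

Definition refines w x := forall h, lower w h ->
  exists2 h', lower x h' & tight w h \subset tight x h'.

Lemma tightP w h l : reflect (h l = w l) (l \in tight w h).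
Proof. by rewrite inE; apply: eqP. Qed.

Lemma affZ (t : R) g : Aff g -> Aff (t *: g).
Proof. by move=> ag; rewrite -[_ *: _]addr0; apply/affP/(aff_cst 0). Qed.

Lemma affD g h : Aff g -> Aff h -> Aff (g + h).
Proof. by move=> ag ah; rewrite -[g]scale1r; apply: affP. Qed.

Lemma affB g h : Aff g -> Aff h -> Aff (g - h).
Proof. by move=> ag ah; rewrite -scaleN1r addrC; apply: affP. Qed.

Lemma lower_exists w : exists h, lower w h.
Proof.
exists (cst (- \sum_l `|w l|)); split; first exact: aff_cst.
move=> l /=; rewrite lerNl (bigD1 l) //= -[leLHS]addr0 lerD ?sumr_ge0 //.
by rewrite -normrN ler_norm.
Qed.

(** Failure of spanning gives a nonzero [g] in [Aff] vanishing on the tight set. Up to sign it is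
    positive somewhere with nonnegative [e]-sum, and [h] moves along it until a new label becomes
    tight. *)
Lemma lower_grow (e : L -> R) w h : (forall l, 0 <= e l) ->
  lower w h -> ~ spanning (tight w h) ->
  exists h', [/\ lower w h', tight w h \proper tight w h'
    & \sum_l e l * h l <= \sum_l e l * h' l].
Proof.
move=> e0 [ah hw] /existsNP[g /not_implyP[ag /not_implyP[gC /existsNP[l0 gl0]]]].
have {g ag gC l0 gl0} [g [l1 [ag gC gl1 Eg]]] : exists g l1, [/\ Aff g,
    forall l, l \in tight w h -> g l = 0, 0 < g l1
    & 0 <= \sum_l e l * g l].
  have key g' : Aff g' -> (forall l, l \in tight w h -> g' l = 0) ->
      0 < \sum_l e l * g' l -> exists g l1, [/\ Aff g,
      forall l, l \in tight w h -> g l = 0, 0 < g l1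
      & 0 <= \sum_l e l * g l].
    move=> ag' g'C E0; have [[l gl]|/forallNP gn] := pselect (exists l, 0 < g' l).
      by exists g', l; split => //; apply: ltW.
    suff : \sum_l e l * g' l <= 0 by rewrite leNgt E0.
    apply: sumr_le0 => l _; rewrite mulr_ge0_le0 //.
    by rewrite leNgt; apply/negP/gn.
  have aN : Aff (- g) by rewrite -scaleN1r; apply: affZ.
  have gNC l : l \in tight w h -> (- g) l = 0.
    by move=> lC; rewrite /GRing.opp /= gC ?oppr0.
  have EN : \sum_l e l * (- g) l = - \sum_l e l * g l.
    by rewrite -sumrN; apply: eq_bigr => l _; rewrite -mulrN.
  have [E0|E0|E0] := ltgtP (\sum_l e l * g l) 0.
  - by apply: (key (- g)) => //; rewrite EN oppr_gt0.
  - exact: (key g).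
  - have [gl|gl|//] := ltgtP (g l0) 0.
    + exists (- g), l0; split => //; first by rewrite oppr_gt0.
      by rewrite EN E0 oppr0.
    + by exists g, l0; split => //; rewrite E0.
(* The step at which [l] becomes tight; the smallest one over labels with [g] positive keeps the
   function below [w]. *)
pose q l := (w l - h l) / g l.
case: (@Order.TotalTheory.arg_minP _ _ _ l1 (fun l => 0 < g l) q gl1) => l2 gl2 min2.
have q0 : 0 <= q l2 by rewrite divr_ge0 ?subr_ge0 // ltW.
exists (q l2 *: g + h); split.
- split; first exact: affP.
  move=> l; have -> : (q l2 *: g + h) l = q l2 * g l + h l by [].
  have [gl|gl] := ltP 0 (g l).
    by rewrite -lerBrDr -ler_pdivlMr //; apply: min2.
  by apply: le_trans (hw l); rewrite gerDr mulr_ge0_le0.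
- apply/properP; split.
    apply/fintype.subsetP => l lC; rewrite inE; apply/eqP.
    have -> : (q l2 *: g + h) l = q l2 * g l + h l by [].
    by rewrite gC // mulr0 add0r; apply/tightP.
  exists l2.
    rewrite inE; apply/eqP.
    have -> : (q l2 *: g + h) l2 = q l2 * g l2 + h l2 by [].
    by rewrite divfK ?gt_eqF // subrK.
  by apply/negP => /gC gl; rewrite gl ltxx in gl2.
- have -> : \sum_l e l * (q l2 *: g + h) l
      = q l2 * (\sum_l e l * g l) + \sum_l e l * h l.
    rewrite mulr_sumr -big_split /=; apply: eq_bigr => l _.
    have -> : (q l2 *: g + h) l = q l2 * g l + h l by [].
    by rewrite mulrDr mulrCA.
  by rewrite lerDr mulr_ge0.
Qed.

(** Iterates [lower_grow]; the complement of the tight set shrinks each time. *)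
Lemma lower_spanning_ge (e : L -> R) w h : (forall l, 0 <= e l) -> lower w h ->
  exists h', [/\ lower w h', tight w h \subset tight w h',
    spanning (tight w h') & \sum_l e l * h l <= \sum_l e l * h' l].
Proof.
move=> e0; have [n] := ubnP #|~: tight w h|.
elim: n h => // n IH h; rewrite ltnS => hn lh.
have [sp|nsp] := pselect (spanning (tight w h)); first by exists h.
have [h1 [lh1 h1h E1]] := lower_grow e0 lh nsp.
have [|h2 [lh2 s2 sp2 E2]] := IH h1 _ lh1.
  apply: leq_trans hn; apply: proper_card.
  by rewrite properC.
exists h2; split => //; first exact: fintype.subset_trans (proper_sub h1h) s2.
exact: le_trans E2.
Qed.

Lemma lower_spanning w h : lower w h ->
  exists h', [/\ lower w h', tight w h \subset tight w h'
    & spanning (tight w h')].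
Proof.
move=> lh; have [h' [? ? ? _]] := lower_spanning_ge (e := fun=> 0) (fun=> lexx 0) lh.
by exists h'.
Qed.

Lemma spanning_inj C g h : spanning C -> Aff g -> Aff h ->
  (forall l, l \in C -> g l = h l) -> g = h.
Proof.
move=> sC ag ah gh; apply/funext => l; apply/eqP; rewrite -subr_eq0; apply/eqP.
by apply: (sC (g - h) (affB ag ah)) => k kC; apply/eqP; rewrite subr_eq0 gh.
Qed.

Lemma spanning_maximal w g h : lower w g -> lower w h ->
  spanning (tight w g) -> tight w g \subset tight w h -> h = g.
Proof.
move=> [ag _] [ah _] sg /fintype.subsetP gh; symmetry.
apply: (spanning_inj sg) => // l lg.
by move/tightP: (lg) ->; move/tightP: (gh _ lg) ->.
Qed.

(* Every lower function is dominated by one with a spanning tight set, and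
   these are determined by that set, so only finitely many values compete. *)
Lemma lower_max (e : L -> R) w : (forall l, 0 <= e l) ->
  exists2 h, lower w h
    & forall h', lower w h' -> \sum_l e l * h' l <= \sum_l e l * h l.
Proof.
move=> e0; have [h0 lh0] := lower_exists w.
pose Q C := [set h | [/\ lower w h, spanning C & tight w h = C]].
pose H C := xget h0 (Q C).
(* The default [h0] is lower as well, so every [C] supplies an admissible competitor. *)
have lH C : lower w (H C) by rewrite /H; case: xgetP => // h _ [].
pose v C : R := \sum_l e l * H C l.
case: (@Order.TotalTheory.arg_maxP _ _ _ finset.set0 xpredT v isT) => C _ Cmax.
exists (H C) => // h lh; have [h' [lh' _ sp hh']] := lower_spanning_ge e0 lh.
apply: le_trans hh' _; suff <- : H (tight w h') = h' by apply: Cmax.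
have [l1 _ t1] : Q (tight w h') (H (tight w h')) by apply: (xgetPex h0); exists h'.
by apply: (@spanning_maximal w) => //; rewrite t1.
Qed.

(** First-order optimality: [g] is nonpositive wherever [h] has no slack, so a small step along [g]
    stays lower and cannot increase the maximal sum. *)
Lemma lower_maxP (e : L -> R) w h g : lower w h ->
  (forall h', lower w h' -> \sum_l e l * h' l <= \sum_l e l * h l) ->
  Aff g -> (forall l, l \in tight w h -> g l <= 0) -> \sum_l e l * g l <= 0.
Proof.
move=> [ah hw] hmax ag gC.
have [|l|t t0 tg] := @small_step R L (fun l => w l - h l) g.
- by move=> l; rewrite subr_ge0.
- by move=> /eqP; rewrite subr_eq0 => /eqP hl; apply: gC; apply/tightP.
have := hmax (t *: g + h); have -> : \sum_l e l * (t *: g + h) l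
      = t * (\sum_l e l * g l) + \sum_l e l * h l.
  rewrite mulr_sumr -big_split /=; apply: eq_bigr => l _.
  have -> : (t *: g + h) l = t * g l + h l by [].
  by rewrite mulrDr mulrCA.
rewrite gerDr pmulr_rle0 //; apply; split; first exact: affP.
by move=> l; rewrite -lerBrDr; apply: tg.
Qed.

Lemma refines_refl w : refines w w.
Proof. by move=> h lh; exists h. Qed.

Lemma refines_trans x w y : refines w x -> refines x y -> refines w y.
Proof.
move=> wx xy h /wx[h' /xy[h'' ly s2] s1]; exists h'' => //.
exact: fintype.subset_trans s1 s2.
Qed.

Lemma refines0 w : refines w 0.
Proof.
move=> h _; exists 0; first by split => //; apply: (aff_cst 0).
by apply/fintype.subsetP => l _; apply/tightP.
Qed.

Lemma refinesD w x y : refines w x -> refines w y -> refines w (x + y).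
Proof.
move=> wx wy h lh; have [hx [ax lx] sx] := wx _ lh; have [hy [ay ly] sy] := wy _ lh.
exists (hx + hy); first by split; [exact: affD|move=> l; apply: lerD].
apply/fintype.subsetP => l lw; apply/tightP.
move/fintype.subsetP/(_ _ lw)/tightP: sx; move/fintype.subsetP/(_ _ lw)/tightP: sy.
by rewrite /GRing.add /= => -> ->.
Qed.

Lemma refinesZ w x (t : R) : 0 <= t -> refines w x -> refines w (t *: x).
Proof.
move=> t0 wx h lh; have [hx [ax lx] sx] := wx _ lh.
exists (t *: hx); first by split; [exact: affZ|move=> l; apply: ler_wpM2l].
apply/fintype.subsetP => l lw; apply/tightP.
by move/fintype.subsetP/(_ _ lw)/tightP: sx; rewrite /GRing.scale /= => ->.
Qed.

(* Sum over the tight set [D] of a lower function [h] of [x + y], and let [C]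
   be the tight set of a maximizer for [w]: a function of [Aff] that is
   nonpositive on [C] has nonpositive sum. Applied to [h - hx - hy], this
   forces [hx] to agree with [x] on [D]. *)
Lemma refines_addl w x y : refines w x -> refines w y -> refines (x + y) x.
Proof.
move=> wx wy h lh; pose e l : R := (l \in tight (x + y) h)%:R.
have [|hw lw wmax] := @lower_max e w; first by move=> l; rewrite ler0n.
have [hx lx /fintype.subsetP sx] := wx _ lw.
have [hy ly /fintype.subsetP sy] := wy _ lw.
exists hx => //.
have gE l : (h - (hx + hy)) l = h l - (hx l + hy l) by [].
have := @lower_maxP e w hw (h - (hx + hy)) lw wmax.
case: lh lx ly => ah lh [ax lx] [ay ly] /(_ (affB ah (affD ax ay))).
have eE l : e l * (h - (hx + hy)) l = e l * (x l - hx l) + e l * (y l - hy l).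
  rewrite gE /e; case: (tightP (x + y) h l) => [->|_]; last by rewrite !mul0r addr0.
  by rewrite -mulrDr opprD addrACA.
have e0 l : 0 <= e l by rewrite ler0n.
have ex l : 0 <= e l * (x l - hx l) by rewrite mulr_ge0 // subr_ge0.
have ey l : 0 <= e l * (y l - hy l) by rewrite mulr_ge0 // subr_ge0.
rewrite (eq_bigr _ (fun l _ => eE l)) => le0; apply/fintype.subsetP => l lD.
have : \sum_l (e l * (x l - hx l) + e l * (y l - hy l)) = 0.
  apply/eqP; rewrite eq_le sumr_ge0 ?andbT => [|i _]; last exact: addr_ge0.
  apply: le0 => i iC; rewrite gE; move/tightP: (sx _ iC) ->; move/tightP: (sy _ iC) ->.
  by rewrite subr_le0; apply: lh.
move/eqP; rewrite psumr_eq0 => [/allP/(_ l)|i _]; last exact: addr_ge0.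
rewrite mem_index_enum => /(_ isT) /=; rewrite paddr_eq0 // => /andP[].
rewrite /e lD mul1r subr_eq0 => /eqP lx' _; exact/tightP.
Qed.

Lemma refines_spanning w x :
  (forall h, lower w h -> spanning (tight w h) ->
     exists2 h', lower x h' & tight w h \subset tight x h') -> refines w x.
Proof.
move=> H h lh; have [h1 [l1 s1 sp1]] := lower_spanning lh.
have [h2 l2 s2] := H _ l1 sp1; exists h2 => //.
exact: fintype.subset_trans s1 s2.
Qed.

(** A spanning tight set determines its lower function [h], so only finitely many pairs of [h] for
    [w] and [h'] for [x] matter. That [h - e h'] be lower for [w - e x] means [e (x - h') <= w - h],
    and [small_step] gives one [e] for all pairs and labels. *)
Lemma refines_sub w x : refines w x ->
  exists2 e : R, 0 < e & refines w (w - e *: x).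
Proof.
move=> wx.
pose Q C := [set h | [/\ lower w h, spanning C & tight w h = C]].
have [f fP] : exists f : {set L} -> (L -> R^o) * (L -> R^o),
    forall C, (exists h, Q C h) -> Q C (f C).1 /\ lower x (f C).2 /\ C \subset tight x (f C).2.
  suff /choice[f fP] : forall C, exists p : (L -> R^o) * (L -> R^o),
      (exists h, Q C h) -> Q C p.1 /\ lower x p.2 /\ C \subset tight x p.2 by exists f.
  move=> C; have [[h [lh sp tC]]|nQ] := pselect (exists h, Q C h); last by exists (0, 0).
  by have [h' lx s] := wx _ lh; exists (h, h') => _; split; [|split; rewrite -?tC].
(* Sets that are not spanning tight sets of [w] get the trivial constraint [0 <= 0]. *)
pose s (i : {set L} * L) : R :=
  if `[< exists h, Q i.1 h >] then w i.2 - (f i.1).1 i.2 else 0.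
pose g (i : {set L} * L) : R :=
  if `[< exists h, Q i.1 h >] then x i.2 - (f i.1).2 i.2 else 0.
have [|i|e e0 eP] := @small_step R _ s g.
- move=> i; rewrite /s; case: ifPn => // /asboolP/fP[[[_ lw] _ _] _].
  by rewrite subr_ge0.
- rewrite /s /g; case: ifPn => // /asboolP/fP[[_ _ tC] [_ /fintype.subsetP sC]].
  move/eqP; rewrite subr_eq0 eq_sym => ts; rewrite subr_le0.
  have /sC/tightP -> // : i.2 \in i.1.
  by rewrite -tC inE.
exists e => //; apply: refines_spanning => h lh sp.
have QC : exists h', Q (tight w h) h' by exists h.
have [[[a1 l1] _ t1] [[a2 l2] /fintype.subsetP s2]] := fP _ QC.
set h1 := (f _).1 in a1 l1 t1; set h2 := (f _).2 in a2 l2 s2.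
(* The chosen function need not be [h] a priori; spanning forces the two to agree. *)
have h1E : h1 = h by apply: (@spanning_maximal w) => //; rewrite t1.
exists (h1 - e *: h2).
  split; first by apply: affB => //; apply: affZ.
  move=> l; have := eP (tight w h, l).
  rewrite /s /g; case: asboolP => // _ /=; rewrite -/h1 -/h2 => el.
  have -> : (h1 - e *: h2) l = h1 l - e * h2 l by [].
  have -> : (w - e *: x) l = w l - e * x l by [].
  by rewrite -subr_ge0 opprD addrACA -opprD subr_ge0 -mulrBr.
apply/fintype.subsetP => l lD; apply/tightP.
have -> : (h1 - e *: h2) l = h1 l - e * h2 l by [].
have -> : (w - e *: x) l = w l - e * x l by [].
by move/tightP: (s2 _ lD) ->; rewrite h1E; move/tightP: lD ->.
Qed.

End LowerFunctions.

(** * Linear functionals on the space of weights and their continuity *)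

Section WeightSpace.
Variables (R : realType) (L : finType).
Implicit Types (x y : L -> R^o) (c : L -> R).

Definition wsum c x : R := \sum_l c l * x l.

Lemma wsum_is_linear c : linear_for *%R (wsum c).
Proof.
move=> t x y; rewrite /wsum mulr_sumr -big_split; apply: eq_bigr => l _ /=.
by rewrite [(t *: x + y) l]/(t * x l + y l) mulrDr mulrCA.
Qed.

HB.instance Definition _ c :=
  GRing.isLinear.Build R (L -> R^o) R *%R (wsum c) (wsum_is_linear c).

Lemma scalar_wsum (u : {scalar (L -> R^o)}) :
  exists c, forall x, u x = \sum_l c l * x l.
Proof.
pose d l : L -> R^o := fun k => (k == l)%:R.
exists (fun l => u (d l)) => x.
have dE l k : ((x l : R) *: d l) k = if k == l then x k else 0.
  by rewrite /d [LHS]/(_ * _); case: eqP => [->|_]; [exact: mulr1|exact: mulr0].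
have {1}-> : x = \sum_l (x l : R) *: d l.
  apply/funext => k; rewrite fct_sumE (bigD1 k) //= big1 => [|l lk].
    by rewrite addr0 dE eqxx.
  by rewrite dE eq_sym (negbTE lk).
rewrite linear_sum; apply: eq_bigr => l _.
by rewrite linearZ mulrC.
Qed.

Lemma scalar_continuous (u : {scalar (L -> R^o)}) : continuous (u : _ -> R^o).
Proof.
have [c cE] := scalar_wsum u.
have -> : (u : (L -> R^o) -> R^o) = (fun x => \sum_(l <- index_enum L) c l *: x l).
  by apply/funext.
elim: (index_enum L) => [|l s IH].
  have -> : (fun x : L -> R^o => \sum_(l <- [::]) c l *: x l) = cst (0 : R^o).
    by apply/funext => y; rewrite big_nil.
  exact: cst_continuous.
have -> : (fun x : L -> R^o => \sum_(l <- l :: s) c l *: x l)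
    = (fun x => c l *: x l + \sum_(l <- s) c l *: x l).
  by apply/funext => y; rewrite big_cons.
move=> x; apply: (@cvgD R R^o _ (nbhs x) _ _ _ _ _ _ (IH x)).
apply: (@cvgZ R R^o _ (nbhs x) _ (cst (c l)) _ (c l)); first exact: cvg_cst.
exact: (@proj_continuous L (fun=> R^o) l x).
Qed.

Lemma line_cvg x y : (fun t : R => x + t *: y) @ 0^'+ --> x.
Proof.
apply/cvg_sup => i U [V] [[W] oW <-] Wx WU.
apply: (filterS WU); rewrite nbhs_simpl /=.
have /(_ W) : (fun t : R => (x i + t * y i : R^o)) @ 0^'+ --> (x i : R^o).
  rewrite -[X in _ --> X]addr0 -[X in _ --> _ + X](mul0r (y i)).
  apply: cvgD; first exact: cvg_cst.
  apply: cvgM; last exact: cvg_cst.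
  by apply: cvg_at_right_filter; apply: cvg_id.
by apply; apply: open_nbhs_nbhs.
Qed.

End WeightSpace.

(** * Closures, relative interiors and faces of polyhedral cones *)

Section PolyhedralCones.
Variables (R : realType) (L : finType).
Implicit Types (x y w : L -> R^o) (P Q : set (L -> R^o)).

Lemma polyhedral_coneD P x y : polyhedral_cone P -> P x -> P y -> P (x + y).
Proof.
by move=> [N [u ->]] Px Py i; rewrite linearD addr_ge0 ?Px ?Py.
Qed.

Lemma polyhedral_coneZ P (t : R) x : polyhedral_cone P -> 0 <= t -> P x -> P (t *: x).
Proof. by move=> [N [u ->]] t0 Px i; rewrite linearZ mulr_ge0 ?Px. Qed.

Lemma polyhedral_cone_closed P : polyhedral_cone P -> closed P.
Proof.
move=> [N [u ->]].
have -> : [set x | forall i, 0 <= u i x] =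
    \bigcap_(i in [set: 'I_N]) ((u i : (L -> R^o) -> R^o) @^-1` [set r : R^o | 0 <= r]).
  by apply/seteqP; split => x /= xP i *; apply: xP.
apply: closed_bigI => i _; apply: closed_comp; last exact: closed_ge.
by move=> x _; apply: scalar_continuous.
Qed.

(* For a polyhedral cone this is membership in the relative interior. *)
Definition interior_point P w :=
  P w /\ forall y, P y -> exists2 e : R, 0 < e & P (w - e *: y).

(** One inclusion holds because [P] is closed. For the other, [x + t w] with [t] tending to 0 from
    above approaches [x] through the given set. *)
Lemma polyhedral_closure P w : polyhedral_cone P -> interior_point P w ->
  closure [set x | P x /\ exists2 e : R, 0 < e & P (x - e *: w)] = P.
Proof.
move=> cP [Pw _]; apply/seteqP; split.
  rewrite closureE => x; apply; split; first exact: polyhedral_cone_closed.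
  by move=> y [].
move=> x Px B nxB; have := @line_cvg R L x w B nxB; rewrite nbhs_simpl /= => nB.
near (0 : R)^'+ => t.
have t0 : 0 < t by near: t; apply: nbhs_right_gt.
exists (x + t *: w); split; last by near: t.
split; first by apply: polyhedral_coneD => //; apply: polyhedral_coneZ => //; apply: ltW.
by exists t => //; rewrite addrK.
Unshelve. all: by end_near. Qed.

(** A relative interior point [x] allows the segment from [w] to be prolonged slightly beyond [x]
    inside [P]. Conversely, each functional either vanishes at [w], hence on the affine hull, or is
    positive at [x] and therefore near it. *)
Lemma polyhedral_relint P w : polyhedral_cone P -> interior_point P w ->
  relint P = [set x | P x /\ exists2 e : R, 0 < e & P (x - e *: w)].
Proof.
move=> cP [Pw wP]; apply/seteqP; split => x [Px].
  move=> nx; split => //.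
  have := @line_cvg R L x (x - w) _ nx; rewrite nbhs_simpl /= => nB.
  near (0 : R)^'+ => t.
  have t0 : 0 < t by near: t; apply: nbhs_right_gt.
  (* As an affine combination of [x] and [w] this point lies in the affine hull; dividing by [1 + t]
     gives the required multiple of [w]. *)
  have yE : x + t *: (x - w) = (1 + t) *: x + (- t) *: w.
    by rewrite scalerDl scale1r scalerBr scaleNr addrA.
  have Py : P ((1 + t) *: x + (- t) *: w).
    rewrite -yE; have : aff_hull P (x + t *: (x - w)) -> P (x + t *: (x - w)).
      by near: t.
    apply; rewrite yE.
    exists 2, (fun i => if i == ord0 then x else w),
      (fun i => if i == ord0 then 1 + t else - t); split.
    - by move=> i; case: ifP.
    - by rewrite !big_ord_recl big_ord0 /= addr0 addrK.
    - by rewrite !big_ord_recl big_ord0 /= addr0.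
  have t1 : 0 < 1 + t by rewrite addr_gt0.
  exists ((1 + t)^-1 * t); first by rewrite mulr_gt0 ?invr_gt0.
  have := @polyhedral_coneZ P (1 + t)^-1 _ cP _ Py; rewrite invr_ge0 ltW // => /(_ isT).
  by rewrite scalerDr !scalerA mulVf ?gt_eqF // scale1r mulrN scaleNr.
move=> [e e0 Pe]; split => //.
case: cP => N [u PE].
have uP y i : P y -> 0 <= u i y by rewrite PE.
have aff0 i : u i w = 0 -> forall y, aff_hull P y -> u i y = 0.
  move=> uw y [M [p [t [pP _ ->]]]]; rewrite linear_sum big1 // => j _.
  rewrite linearZ /=; suff -> : u i (p j) = 0 by rewrite mulr0.
  apply/eqP; rewrite eq_le uP // andbT; have [d d0 /(uP _ i)] := wP _ (pP j).
  by rewrite linearB linearZ /= uw sub0r oppr_ge0 pmulr_rle0.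
have near_i i : \forall y \near x, aff_hull P y -> 0 <= u i y.
  have [uw|uw] := eqVneq (u i w) 0.
    by apply: (@filterS _ (nbhs x) (nbhs_filter x) setT) => [y _ /(aff0 _ uw) ->|];
      last exact: filterT.
  have uwi : 0 < u i w by rewrite lt0r uw uP.
  have uxi : 0 < u i x.
    have := uP _ i Pe; rewrite linearB linearZ /= subr_ge0; apply: lt_le_trans.
    by rewrite mulr_gt0.
  have nu : nbhs (u i x : R^o) [set r : R^o | 0 < r].
    by apply: open_nbhs_nbhs; split; first exact: open_gt.
  have : \forall y \near x, 0 < u i y := @scalar_continuous _ _ (u i) x _ nu.
  by apply: filterS => y /= uy _; apply: ltW.
have := @filter_forall _ _ (fun i => [set y | aff_hull P y -> 0 <= u i y])
  (nbhs x) (nbhs_filter x) near_i.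
by apply: (@filterS _ (nbhs x) (nbhs_filter x)) => y uy ay; rewrite PE => i; apply: uy.
Unshelve. all: by end_near. Qed.

(** The minimum of [f] on a cone is 0: compare a minimizer with its multiples by 0 and by 2. *)
Lemma face_cone P F : polyhedral_cone P -> face P F ->
  exists2 f : {scalar (L -> R^o)}, forall x, P x -> 0 <= f x
    & F = [set x | P x /\ f x = 0].
Proof.
move=> cP [[x0 Fx0] [f FE]]; exists f; last first.
  have f0 : f x0 = 0.
    move: Fx0; rewrite FE => -[Px0 fx0]; apply/eqP; rewrite eq_le; apply/andP; split.
      rewrite -[leRHS](linear0 f) fx0 // -(scale0r x0).
      exact: polyhedral_coneZ.
    have := fx0 _ (polyhedral_coneD cP Px0 Px0).
    by rewrite linearD lerDl.
  move: Fx0; rewrite FE => -[Px0 fx0]; apply/seteqP; split => x [Px fx]; split => //.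
    by apply/eqP; rewrite eq_le -{1}f0 fx //= -f0 fx0.
  by move=> y Py; rewrite fx -f0 fx0.
have f0 : f x0 <= 0.
  move: Fx0; rewrite FE => -[Px0 fx0]; rewrite -[leRHS](linear0 f) fx0 // -(scale0r x0).
  exact: polyhedral_coneZ.
move: Fx0; rewrite FE => -[Px0 fx0] x Px.
have := fx0 _ (polyhedral_coneD cP Px0 Px0); rewrite linearD lerDl => f0'.
exact: le_trans f0' (fx0 _ Px).
Qed.

(** Take [v] in [Q] with as many positive defining functionals as possible. Adding [x] cannot create
    another, so a functional vanishing at [v] is not positive at [x], and [small_step] applies. *)
Lemma cone_generic_point P Q : polyhedral_cone P -> Q `<=` P -> Q !=set0 ->
    (forall x y, Q x -> Q y -> Q (x + y)) ->
  exists2 v, Q v & forall x, Q x -> exists2 e : R, 0 < e & P (v - e *: x).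
Proof.
move=> [N [u PE]] QP [x0 Qx0] QD.
have QPi x i : Q x -> 0 <= u i x by move/QP; rewrite PE => /(_ i).
pose S v := finset (fun i => 0 < u i v).
pose p n := `[< exists2 v, Q v & #|S v| = n >].
have p0 : exists n, p n by exists #|S x0|; apply/asboolP; exists x0.
have pN n : p n -> (n <= N)%N.
  by move=> /asboolP[v _ <-]; rewrite -[leqRHS]card_ord max_card.
case: (ex_maxnP p0 pN) => n /asboolP[v Qv Sv] nmax.
exists v => // x Qx.
have [|i|e e0 eP] := @small_step R _ (u^~ v) (u^~ x); first by move=> i; apply: QPi.
  move=> uv; rewrite leNgt; apply/negP => ux.
  suff : (#|S (v + x)%R| <= #|S v|)%N.
    rewrite leqNgt => /negP; apply; apply: proper_card; apply/properP; split.
      apply/fintype.subsetP => j; rewrite !inE linearD => uvj.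
      by rewrite ltr_pwDl // QPi.
    by exists i; rewrite !inE ?linearD uv ?add0r // ltxx.
  by rewrite Sv; apply: nmax; apply/asboolP; exists (v + x) => //; apply: QD.
by exists e => //; rewrite PE => i; rewrite linearB linearZ /= subr_ge0.
Qed.

Lemma scalar_sum (I : Type) (s : seq I) (u : I -> {scalar (L -> R^o)}) :
  exists f : {scalar (L -> R^o)}, forall x, f x = \sum_(i <- s) u i x.
Proof.
elim: s => [|i s [f fE]].
  by exists (wsum (fun=> 0)) => x; rewrite big_nil /= /wsum big1 // => l _; rewrite mul0r.
by exists (u i \+ f) => x; rewrite big_cons /= fE.
Qed.

(** This is the smallest face containing [v]. The sum of the defining functionals that vanish at [v]
    cuts it out. *)
Lemma polyhedral_face P v : polyhedral_cone P -> P v ->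
  face P [set x | P x /\ exists2 e : R, 0 < e & P (v - e *: x)].
Proof.
move=> [N [u PE]] Pv; split.
  by exists v; split => //; exists 1 => //; rewrite scale1r subrr PE => i; rewrite linear0.
have [f fE] := scalar_sum [seq i <- enum 'I_N | u i v == 0] u.
have {}fE x : f x = \sum_(i | u i v == 0) u i x by rewrite fE big_filter big_enum_cond.
have f0 y : P y -> 0 <= f y by rewrite PE => Py; rewrite fE sumr_ge0.
exists f; apply/seteqP; split => x [Px].
  move=> [e e0 Pe]; split => // y Py; apply: le_trans (f0 _ Py).
  rewrite fE sumr_le0 // => i /eqP uv; move: Pe; rewrite PE => /(_ i).
  by rewrite linearB linearZ /= uv sub0r oppr_ge0 pmulr_rle0.
move=> fx; split => //.
have [||e e0 eP] := @small_step R _ (u^~ v) (u^~ x).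
- by move: Pv; rewrite PE.
- move=> i /eqP uv; have : f x <= f v by apply: fx.
  rewrite [f v]fE big1 => [|j /eqP //]; rewrite fE (bigD1 i) //=.
  apply: le_trans; rewrite lerDl sumr_ge0 // => j _.
  by move: Px; rewrite PE.
by exists e => //; rewrite PE => i; rewrite linearB linearZ /= subr_ge0.
Qed.

End PolyhedralCones.

(** * Affine functions on a configuration, interpolation, and polyhedrality of refinement *)

Section AffineFunctions.
Variables (R : realType) (d : nat) (L : finType) (a : L -> 'rV[R]_d).
Implicit Types (C : {set L}) (g h w x : L -> R^o).

Definition affine_on : set (L -> R^o) :=
  [set h | exists (y : 'cV[R]_d) (c : R), forall l, h l = (a l *m y) 0 0 + c].

Lemma affine_onP (t : R) g h : affine_on g -> affine_on h -> affine_on (t *: g + h).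
Proof.
move=> [y [c gE]] [z [e hE]]; exists (t *: y + z), (t * c + e) => l.
rewrite [LHS]/(t * g l + h l) gE hE mulmxDr -scalemxAr !mxE mulrDr.
by rewrite addrACA.
Qed.

Lemma affine_on_cst (c : R) : affine_on (cst c).
Proof. by exists 0, c => l; rewrite mulmx0 mxE add0r. Qed.

Let hom l : 'rV[R]_(d + 1) := row_mx (a l) 1.

Let homE (y : 'cV[R]_(d + 1)) l :
  (hom l *m y) 0 0 = (a l *m usubmx y) 0 0 + dsubmx y 0 0.
Proof.
by rewrite -{1}[y]vsubmxK mul_row_col mul1mx mxE.
Qed.

(** The rows of [M] are the homogeneous coordinates of the points of [C], padded by zero rows. Its
    pseudo-inverse recovers an affine function from its values on [C], by a formula linear in those
    values. *)
Lemma interpolation C : spanning affine_on C ->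
  exists K : L -> L -> R,
    (forall w, affine_on (fun l => \sum_k K l k * w k)) /\
    (forall w h, affine_on h -> (forall l, l \in C -> h l = w l) ->
       forall l, \sum_k K l k * w k = h l).
Proof.
move=> sC.
pose M : 'M[R]_(#|L|, d + 1) :=
  \matrix_(i, j) (if enum_val i \in C then hom (enum_val i) 0 j else 0).
pose K l k := if k \in C then (hom l *m pinvmx M) 0 (enum_rank k) else 0.
pose W w : 'cV[R]_#|L| := \col_i (if enum_val i \in C then w (enum_val i) else 0).
have KE w l : \sum_k K l k * w k = (hom l *m (pinvmx M *m W w)) 0 0.
  rewrite mulmxA [RHS]mxE (reindex_onto (@enum_val L L) enum_rank) /=; last first.
    by move=> k _; rewrite enum_rankK.
  apply: eq_big => [i|i _]; first by rewrite enum_valK eqxx.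
  by rewrite /K [W _ _ _]mxE enum_valK; case: ifP; rewrite ?mul0r ?mulr0.
exists K; split=> [w|w h [y [c hE]] hw l].
  exists (usubmx (pinvmx M *m W w)), (dsubmx (pinvmx M *m W w) 0 0) => l.
  by rewrite KE homE.
(* Each column of the cokernel of [M] is an affine function vanishing on [C], so spanning makes it
   vanish at every label. *)
have hM : (hom l <= M)%MS.
  rewrite submxE; apply/eqP/matrixP => i j; rewrite ord1 [RHS]mxE.
  have af : affine_on (fun l => (hom l *m col j (cokermx M)) 0 0).
    exists (usubmx (col j (cokermx M))), (dsubmx (col j (cokermx M)) 0 0) => k.
    exact: homE.
  transitivity ((hom l *m col j (cokermx M)) 0 0).
    by rewrite [LHS]mxE [RHS]mxE; apply: eq_bigr => k _; rewrite [col _ _ _ _]mxE.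
  apply: (sC _ af) => k kC.
  have /matrixP/(_ (enum_rank k) j) := mulmx_coker M.
  rewrite [X in X = _ -> _]mxE [X in _ = X -> _]mxE => e0; rewrite -[RHS]e0 mxE.
  apply: eq_bigr => s _.
  by rewrite [M _ _]mxE enum_rankK kC [col _ _ _ _]mxE.
pose Y : 'cV[R]_(d + 1) := col_mx y c%:M.
have hY k : h k = (hom k *m Y) 0 0.
  by rewrite homE col_mxKu col_mxKd hE [c%:M _ _]mxE mulr1n.
rewrite KE; have -> : W w = M *m Y.
  apply/colP => i; rewrite [LHS]mxE [RHS]mxE; case: ifP => iC.
    rewrite -hw // hY mxE; by apply: eq_bigr => j _; rewrite [M _ _]mxE iC.
  by rewrite big1 // => j _; rewrite [M _ _]mxE iC mul0r.
by rewrite mulmxA mulmxA mulmxKpV // -hY.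
Qed.

(** Only spanning tight sets [C] of [w] need testing. For each, the interpolant of [x] from [C] must
    be at most [x] everywhere (flag [false]) and at least [x] on [C] (flag [true]); these are
    finitely many linear inequalities in [x]. *)
Lemma refines_polyhedral w : polyhedral_cone [set x | refines affine_on w x].
Proof.
pose Q C := exists h, [/\ lower affine_on w h, spanning affine_on C & tight w h = C].
have /choice[K KP] : forall C, exists K : L -> L -> R, spanning affine_on C ->
    (forall w, affine_on (fun l => \sum_k K l k * w k)) /\
    (forall w h, affine_on h -> (forall l, l \in C -> h l = w l) ->
       forall l, \sum_k K l k * w k = h l).
  move=> C; have [sC|nC] := pselect (spanning affine_on C).
    by have [K KP] := interpolation sC; exists K.
  by exists (fun=> fun=> 0).
pose u (i : {set L} * L * bool) (k : L) : R :=
  let: (C, l, b) := i in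
  if `[< Q C >] then
    if b then (if l \in C then K C l k - (k == l)%:R else 0)
    else (k == l)%:R - K C l k
  else 0.
have dE (x : L -> R^o) l : \sum_k (k == l)%:R * x k = x l.
  rewrite (bigD1 l) //= eqxx mul1r big1 ?addr0 // => k /negbTE ->.
  by rewrite mul0r.
pose T : finType := ({set L} * L * bool)%type.
exists #|T|, (fun i => wsum (u (enum_val i))); apply/seteqP; split => x /=.
  move=> wx i; case: (enum_val i) => [[C l] b]; rewrite /wsum /u.
  case: asboolP => [[h [lh sC tC]]|_]; last by rewrite big1 // => k _; rewrite mul0r.
  have [h' [ah' hx] sub] := wx _ lh.
  have Kh : \sum_k K C l k * x k = h' l.
    apply: (KP C sC).2 => // k; rewrite -tC => /(fintype.subsetP sub).
    by move/tightP.
  case: b; last first.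
    under eq_bigr do rewrite mulrBl.
    by rewrite sumrB dE Kh subr_ge0.
  case: (boolP (l \in C)) => lC; last by rewrite big1 // => k _; rewrite mul0r.
  under eq_bigr do rewrite mulrBl.
  rewrite sumrB dE Kh subr_ge0; move: lC; rewrite -tC => /(fintype.subsetP sub).
  by move/tightP ->.
move=> ux; apply: refines_spanning.
- exact: affine_onP.
- exact: affine_on_cst.
move=> h lh sC.
have QC : Q (tight w h) by exists h.
have ge0 l b : 0 <= wsum (u (tight w h, l, b)) x.
  by have := ux (enum_rank ((tight w h, l, b) : T)); rewrite enum_rankK.
have le_l l : \sum_k K (tight w h) l k * x k <= x l.
  have := ge0 l false; rewrite /wsum /u; case: asboolP => // _.
  under eq_bigr do rewrite mulrBl.
  by rewrite sumrB dE subr_ge0.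
exists (fun l => \sum_k K (tight w h) l k * x k).
  by split => //; apply: (KP _ sC).1.
apply/fintype.subsetP => l lC; apply/tightP/eqP; rewrite eq_le le_l /=.
have := ge0 l true; rewrite /wsum /u; case: asboolP => // _; rewrite lC /=.
under eq_bigr do rewrite mulrBl.
by rewrite sumrB dE subr_ge0.
Qed.

End AffineFunctions.

(** * Affine hulls as cosets of subspaces *)

Section AffineHull.
Variables (R : realType) (V : vectType R).
Implicit Types (S : set V) (U : {vspace V}) (x v : V).

Lemma aff_hull_sub S : S `<=` aff_hull S.
Proof.
move=> x Sx; exists 1%N, (fun=> x), (fun=> 1); split => //.
  by rewrite big_ord1.
by rewrite big_ord1 scale1r.
Qed.

Lemma aff_hullS S S' : S `<=` S' -> aff_hull S `<=` aff_hull S'.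
Proof.
move=> SS' x [N [p [t [pS t1 ->]]]]; exists N, p, t; split => // i.
exact: SS'.
Qed.

Lemma aff_hull_addr S (t : R) x s s' : aff_hull S x -> S s -> S s' ->
  aff_hull S (x + t *: (s - s')).
Proof.
move=> [N [p [c [pS c1 ->]]]] Ss Ss'.
(* Prepends [s] and [s'] with weights [t] and [- t], leaving the total weight unchanged. *)
pose ext (T : Type) (u u' : T) (q : 'I_N -> T) (i : 'I_N.+2) :=
  oapp (fun j => oapp q u' (unlift ord0 j)) u (unlift ord0 i).
exists N.+2, (ext _ s s' p), (ext _ t (- t) c); split.
- by move=> i; rewrite /ext; case: unliftP => //= j _; case: unliftP => //= k _.
- rewrite !big_ord_recl /ext unlift_none liftK /= unlift_none /= addNKr -[RHS]c1.
  by apply: eq_bigr => i _; rewrite liftK /= liftK.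
- rewrite !big_ord_recl /ext unlift_none liftK /= unlift_none /= addrA scaleNr scalerBr addrC.
  by congr (_ + _); apply: eq_bigr => i _; rewrite liftK /= liftK.
Qed.

(** A subspace [U] of maximal dimension with [x + U] inside the hull contains each [s - x]:
    otherwise that line could be added to it. *)
Lemma aff_hull_coset S x : S x ->
  exists U, aff_hull S = [set y | y - x \in U].
Proof.
move=> Sx.
pose good U := forall u, u \in U -> aff_hull S (x + u).
pose p n := `[< exists2 U, good U & \dim U = n >].
have p0 : exists n, p n.
  exists 0; apply/asboolP; exists 0%VS; last exact: dimv0.
  by move=> u; rewrite memv0 => /eqP ->; rewrite addr0; apply: aff_hull_sub.
have pN n : p n -> (n <= \dim {:V})%N.
  by move=> /asboolP[U _ <-]; apply/dimvS/subvf.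
case: (ex_maxnP p0 pN) => n /asboolP[U gU <-] nmax.
have SU s : S s -> s - x \in U.
  move=> Ss; apply/negPn/negP => sU.
  have /nmax : p (\dim (U + <[s - x]>)).
    apply/asboolP; exists (U + <[s - x]>)%VS => // _ /memv_addP[u uU [_ /vlineP[t ->] ->]].
    by rewrite addrA; apply: aff_hull_addr => //; apply: gU.
  rewrite leqNgt => /negP; apply.
  rewrite (ltn_leqif (dimv_leqif_sup (addvSl _ _))).
  by rewrite subv_add subvv -memvE.
exists U; apply/seteqP; split => y.
  move=> [N [q [t [qS t1 ->]]]] /=.
  have -> : \sum_i t i *: q i - x = \sum_i t i *: (q i - x).
    under [RHS]eq_bigr do rewrite scalerBr.
    by rewrite sumrB -scaler_suml t1 scale1r.
  by apply: memv_suml => i _; apply/memvZ/SU.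
by move=> /gU; rewrite addrC subrK.
Qed.

(** Subtracting from [v] its projection to [U] leaves a nonzero vector; one of its coordinates is
    the form. *)
Lemma scalar_separates U v : v \notin U ->
  exists2 f : {scalar V}, (forall u, u \in U -> f u = 0) & f v != 0.
Proof.
move=> vU; pose r := (\1 - projv U)%VF.
have rE u : r u = u - projv U u by rewrite !lfunE /= lfunE /= lfunE.
have [c0|/existsNP[i /eqP ci]] :=
  pselect (forall i, coord (vbasis {:V}) i (r v) = 0); last first.
  exists (coord (vbasis {:V}) i \o r) => //= u uU.
  by rewrite rE projv_id // subrr linear0.
have : r v = 0 by rewrite (coord_vbasis (memvf (r v))) big1 // => i _; rewrite c0 scale0r.
rewrite rE => /eqP; rewrite subr_eq0 => /eqP vE.
by rewrite vE memv_proj in vU.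
Qed.

End AffineHull.

(** * Linear forms on row vectors and on the lifted space *)

Section ScalarForms.
Variables (R : realType) (d : nat).
Implicit Types (y : 'cV[R]_d) (s : R).

Definition row_form y (x : 'rV[R]_d) : R := (x *m y) 0 0.

Lemma row_form_is_linear y : linear_for *%R (row_form y).
Proof. by move=> t u v; rewrite /row_form mulmxDl -scalemxAl !mxE. Qed.

HB.instance Definition _ y :=
  GRing.isLinear.Build R 'rV[R]_d R *%R (row_form y) (row_form_is_linear y).

Definition pair_form y s (p : 'rV[R]_d * R^o) : R := row_form y p.1 + p.2 * s.

Lemma pair_form_is_linear y s : linear_for *%R (pair_form y s).
Proof.
move=> t u v; rewrite /pair_form /= linearP mulrDl mulrDr.
by rewrite addrACA -[t *: u.2]/(t * u.2) mulrA.
Qed.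

HB.instance Definition _ y s := GRing.isLinear.Build R
  ('rV[R]_d * R^o)%type R *%R (pair_form y s) (pair_form_is_linear y s).

Lemma scalar_row (f : {scalar 'rV[R]_d}) : exists y, f =1 row_form y.
Proof.
exists (\col_j f (delta_mx 0 j)) => x.
rewrite {1}[x]row_sum_delta linear_sum /row_form mxE.
by apply: eq_bigr => j _; rewrite linearZ !mxE.
Qed.

Lemma scalar_pair (f : {scalar ('rV[R]_d * R^o)%type}) :
  exists y s, f =1 pair_form y s.
Proof.
exists (\col_j f (delta_mx 0 j, 0)), (f (0, 1)) => -[x t].
have -> : (x, t) = \sum_j x 0 j *: (delta_mx 0 j, 0) + t *: (0, 1)
    :> 'rV[R]_d * R^o.
  rewrite [RHS]surjective_pairing /=; congr pair.
    rewrite (big_morph fst (id1 := 0) (op1 := +%R)) //= scaler0 addr0.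
    exact: row_sum_delta.
  rewrite (big_morph snd (id1 := 0) (op1 := +%R)) //= big1 ?add0r.
    by rewrite [RHS]mulr1.
  by move=> j _; rewrite /= scaler0.
rewrite linearD linearZ linear_sum /pair_form /row_form /=; congr (_ + _).
  rewrite mxE (big_morph fst (id1 := 0) (op1 := +%R)) //= scaler0 addr0.
  rewrite -row_sum_delta; apply: eq_bigr => j _.
  by rewrite linearZ !mxE.
rewrite (big_morph snd (id1 := 0) (op1 := +%R)) //= big1 ?add0r => [|j _].
  by rewrite [_%:A]mulr1.
by rewrite /= scaler0.
Qed.

End ScalarForms.

(** * Linear forms on convex and affine hulls *)

Section ConvexHull.
Variables (R : realType) (V : lmodType R).
Implicit Types (S : set V) (f : {scalar V}).

Lemma conv_hull_sub S : S `<=` conv_hull S.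
Proof.
move=> x Sx; exists 1%N, (fun=> x), (fun=> 1); split => //.
  by rewrite big_ord1.
by rewrite big_ord1 scale1r.
Qed.

Lemma conv_hull_ge S f (c : R) x :
  (forall y, S y -> c <= f y) -> conv_hull S x -> c <= f x.
Proof.
move=> Sc [N [p [t [pS t0 t1 ->]]]].
rewrite linear_sum -[c]mul1r -t1 mulr_suml; apply: ler_sum => i _.
by rewrite linearZ ler_wpM2l // Sc.
Qed.

Lemma conv_hull_min S f (c : R) x : (forall y, S y -> c <= f y) ->
  conv_hull S x -> f x = c -> conv_hull [set y | S y /\ f y = c] x.
Proof.
move=> Sc [N [p [t [pS t0 t1 ->]]]]; rewrite linear_sum => fx.
have tight i : t i != 0 -> f (p i) = c.
  move=> ti; have : \sum_i t i * (f (p i) - c) = 0.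
    under eq_bigr do rewrite mulrBr.
    rewrite sumrB -mulr_suml t1 mul1r -[X in _ - X]fx; apply/eqP.
    by rewrite subr_eq0; apply/eqP/eq_bigr => j _; rewrite linearZ.
  move/eqP; rewrite psumr_eq0 => [/allP/(_ i)|j _]; last first.
    by rewrite mulr_ge0 // subr_ge0 Sc.
  rewrite mem_index_enum => /(_ isT) /=.
  by rewrite mulf_eq0 (negbTE ti) subr_eq0 => /eqP.
have [i0 ti0] : exists i, t i != 0.
  apply: contrapT => /forallNP tz; have := oner_neq0 R; rewrite -t1 big1 ?eqxx // => i _.
  by apply/eqP/negPn/negP/tz.
(* Points of weight zero need not attain [c]; they are replaced by [p i0], which does. *)
exists N, (fun i => if t i == 0 then p i0 else p i), t; split => //.
- move=> i; case: ifPn => ti; split => //; exact: tight.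
- by apply: eq_bigr => i _; case: eqP => // ->; rewrite !scale0r.
Qed.

Lemma conv_hull_eq S f (c : R) x :
  (forall y, S y -> f y = c) -> conv_hull S x -> f x = c.
Proof.
move=> Sc [N [p [t [pS t0 t1 ->]]]].
rewrite linear_sum -[c]mul1r -t1 mulr_suml; apply: eq_bigr => i _.
by rewrite linearZ /= Sc.
Qed.

Lemma aff_hull_eq S f (c : R) x :
  (forall y, S y -> f y = c) -> aff_hull S x -> f x = c.
Proof.
move=> Sc [N [p [t [pS t1 ->]]]].
rewrite linear_sum -[c]mul1r -t1 mulr_suml; apply: eq_bigr => i _.
by rewrite linearZ /= Sc.
Qed.

End ConvexHull.

(** * The direction space of an affine hull *)

Section AffineCoset.
Variables (R : realType) (V : vectType R) (S : set V) (x : V) (U : {vspace V}).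
Hypothesis SU : aff_hull S = [set y | y - x \in U].

Lemma coset_add v : v \in U -> aff_hull S (x + v).
Proof. by rewrite SU /= addrC addKr. Qed.

Lemma coset_sub y z : aff_hull S y -> aff_hull S z -> y - z \in U.
Proof.
rewrite SU /= => yU zU; have -> : y - z = (y - x) - (z - x) by rewrite opprB addrA subrK.
by rewrite memvB.
Qed.

Lemma coset_eq0 (f : {scalar V}) (c : R) : (forall y, S y -> f y = c) ->
  forall v, v \in U -> f v = 0.
Proof.
move=> Sc v /coset_add/(aff_hull_eq Sc).
have /(aff_hull_eq Sc) fx : aff_hull S x.
  by rewrite -[x]addr0; apply: coset_add; apply: mem0v.
by rewrite linearD fx => /eqP; rewrite -subr_eq0 addrC addKr => /eqP.
Qed.

End AffineCoset.

(** * Bounded facets of the lifted polyhedron and spanning tight sets *)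

Section FacetCells.
Variables (R : realType) (d : nat) (L : finType) (a : L -> 'rV[R]_d).
Variables (w : L -> R^o).
Implicit Types (C D : {set L}).

Let lift l : 'rV[R]_d * R^o := (a l, w l).
Let P := lifted_polyhedron a w.
Let up : 'rV[R]_d * R^o := (0, 1).

Let lift_in l : P (lift l).
Proof. by exists (lift l) => //; apply: conv_hull_sub; exists l. Qed.

Let up_in p (t : R) : 0 <= t -> P p -> P (p + t *: up).
Proof.
move=> t0 [q qc [p1 p2]]; exists q => //=; rewrite p1 scaler0 addr0; split => //.
by rewrite (le_trans p2) // lerDl [_ *: _]mulr1.
Qed.

Let form_upE y s : pair_form y s up = s.
Proof. by rewrite /pair_form /up linear0 add0r mul1r. Qed.

Let form_up y s p (t : R) : pair_form y s (p + t *: up) = pair_form y s p + t * s.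
Proof.
by rewrite linearD linearZ /= form_upE.
Qed.

Let form_ge y s (c : R) p : 0 <= s -> (forall l, c <= pair_form y s (lift l)) ->
  P p -> c <= pair_form y s p.
Proof.
move=> s0 lc [q qc [p1 p2]].
have := conv_hull_ge (f := pair_form y s) _ qc => /(_ c).
move=> /(_ _)/le_trans -> //; first by move=> _ [l _ <-]; apply: lc.
by rewrite /pair_form p1 lerD2l ler_wpM2r.
Qed.

(** With [s] positive, a point strictly above the hull is not minimal; so a minimizer lies in the
    hull of the lifted points attaining [c]. *)
Let form_min y s (c : R) p : 0 < s -> (forall l, c <= pair_form y s (lift l)) ->
  P p -> pair_form y s p = c ->
  conv_hull [set lift l | l in [set l | pair_form y s (lift l) = c]] p.
Proof.
move=> s0 lc [q qc [p1 p2]] pc.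
have lc' : forall z, range lift z -> c <= pair_form y s z by move=> _ [l _ <-].
have cq : c <= pair_form y s q := conv_hull_ge lc' qc.
have pq : p = q.
  move: p1 p2 pc cq; case: p => p1 p2; case: q {qc} => q1 q2 /= -> qp <-.
  rewrite /pair_form /= lerD2l ler_pM2r // => pq.
  by congr pair; apply/le_anti; rewrite qp pq.
move: (conv_hull_min lc' qc); rewrite -pq => /(_ pc) [N [z [t [zS ? ? ?]]]].
exists N, z, t; split => // i; have [[l _ <-] ?] := zS i; by exists l.
Qed.

(** Boundedness makes the vertical coefficient [s] of the supporting form positive, so its
    hyperplane is the graph of an affine function. Spanning follows by counting dimensions. *)
Lemma facet_cell_spanning C : facet_cell a w C ->
  exists h, [/\ lower (affine_on a) w h, spanning (affine_on a) C & tight w h = C].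
Proof.
move=> [F [[[[x0 Fx0] [f FE]]] [r [[xP [UP [dUP UPE]]] [xF [UF [dUF UFE]]]]] bF CF]].
have [y [s fE]] := scalar_pair f.
have PF x : F x -> P x by rewrite FE => -[].
have Px0 := PF _ Fx0.
have fx0 p : P p -> pair_form y s x0 <= pair_form y s p.
  by rewrite -!fE; move: Fx0; rewrite FE => -[_]; apply.
have FP p : F p <-> P p /\ pair_form y s p = pair_form y s x0.
  rewrite FE; split=> [[Pp fp]|[Pp fp]]; split => //.
    by apply/eqP; rewrite eq_le fx0 // andbT -!fE fp.
  by move=> q Pq; rewrite !fE fp fx0.
have s0 : 0 < s.
  rewrite lt0r; apply/andP; split; last first.
    by have := fx0 _ (up_in ler01 Px0); rewrite form_up mul1r lerDl.
  apply/eqP => s0; have [M [Mr FM]] := bF.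
  have up_gt0 : 0 < `|up|.
    by rewrite normr_gt0 /up xpair_eqE negb_and oner_eq0 orbT.
  (* Chosen so that [x0 + t up] has norm at least [|M| + 1]. *)
  pose t : R := (`|M| + 1 + `|x0|) / `|up|.
  have t0 : 0 <= t by rewrite /t divr_ge0 ?addr_ge0.
  have : F (x0 + t *: up).
    by apply/FP; split; [exact: up_in|rewrite form_up s0 mulr0 addr0].
  have M1 : M < `|M| + 2^-1 by rewrite (le_lt_trans (ler_norm _)) // ltrDl invr_gt0.
  move=> /(FM _ M1) /=; apply/negP; rewrite -ltNge.
  have nup : `|t *: up| = `|M| + 1 + `|x0|.
    by rewrite normrZ ger0_norm // divfK ?gt_eqF.
  apply: lt_le_trans (_ : `|M| + 1 <= _).
    by rewrite ltrD2l invf_lt1 ?ltr1n.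
  rewrite -(lerD2r `|x0|) -nup -[X in `|X| <= _](addKr x0) addrC.
  by rewrite (le_trans (ler_normD _ _)) // normrN.
pose c := pair_form y s x0.
have lc l : c <= pair_form y s (lift l) by apply/fx0/lift_in.
have CE l : l \in C <-> pair_form y s (lift l) = c.
  by rewrite CF FP; split=> [[]//|]; split => //; apply: lift_in.
(* The equation of the supporting hyperplane solved for the height. *)
pose h : L -> R^o := fun l => (a l *m (- s^-1 *: y)) 0 0 + s^-1 * c.
have hE l : w l - h l = s^-1 * (pair_form y s (lift l) - c).
  rewrite /h; move: (c) => b; rewrite -scalemxAr mxE /pair_form /row_form /=.
  rewrite mulrBr mulrDr [s^-1 * (_ * s)]mulrC mulfK ?gt_eqF //.
  by rewrite opprD mulNr opprK addrA [X in X - _ = _]addrC.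
exists h; split.
- split; first by exists (- s^-1 *: y), (s^-1 * c).
  by move=> l; rewrite -subr_ge0 hE mulr_ge0 ?invr_ge0 ?subr_ge0 // ltW.
(* If [g] vanishes on [C] but not at [l1], its linear part is constant on [F]. Then [up] and the
   direction towards [l1] each enlarge the direction space of [F] inside that of [P], contradicting
   codimension one. *)
- move=> g [z [e gE]] gC l1; apply/eqP/negPn/negP => gl1.
  have Fg q : F q -> pair_form z 0 q = - e.
    move=> /FP[Pq fq]; apply: (conv_hull_eq _ (form_min s0 lc Pq fq)).
    move=> _ [l /CE lC <-]; rewrite /= /pair_form mulr0 addr0.
    by apply/eqP; rewrite -addr_eq0 -gE gC.
  have [lc0 lc0C] : exists l, l \in C.
    have [N [p [t [pS _ t1 _]]]] := form_min s0 lc Px0 erefl.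
    case: N p t pS t1 => [p t _|N p t pS _].
      by rewrite big_ord0 => /eqP; rewrite eq_sym oner_eq0.
    by have [l /CE lC _] := pS ord0; exists l.
  have UPB p q : P p -> P q -> p - q \in UP.
    by move=> Pp Pq; apply: (coset_sub UPE); apply: aff_hull_sub.
  have sUFP : (UF <= UP)%VS.
    apply/subvP => v vF; rewrite -[v](addKr xF) addrC.
    apply: (coset_sub UPE); apply: (aff_hullS PF); first exact: (coset_add UFE).
    by rewrite -[xF]addr0; apply: (coset_add UFE); rewrite mem0v.
  pose u := lift l1 - lift lc0.
  have gu : pair_form z 0 u != 0.
    rewrite linearB /= {1 2}/pair_form !mulr0 !addr0.
    have := gC _ lc0C; rewrite gE => /eqP; rewrite addr_eq0 => /eqP.
    by rewrite /row_form /= => ->; rewrite opprK -gE.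
  have up0 := form_upE z 0.
  have upF : up \notin UF.
    apply/negP => upF; have Fc q : F q -> f q = c by move=> /FP[_]; rewrite fE.
    have := coset_eq0 UFE Fc upF; rewrite fE form_upE => s00.
    by rewrite s00 ltxx in s0.
  have uF : u \notin (UF + <[up]>)%VS.
    apply/negP => /memv_addP[v vF [_ /vlineP[t ->] uE]].
    by move: gu; rewrite uE linearD linearZ /= up0 mulr0 addr0 (coset_eq0 UFE Fg) ?eqxx.
  have lt_dim (U : {vspace 'rV[R]_d * R^o}) v : v \notin U -> (\dim U < \dim (U + <[v]>))%N.
    move=> vU; rewrite (ltn_leqif (dimv_leqif_sup (addvSl _ _))).
    by rewrite subv_add subvv -memvE.
  have := leq_ltn_trans (lt_dim _ _ upF) (lt_dim _ _ uF).
  rewrite dUF ltnNge -dUP => /negP; apply; apply: dimvS.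
  rewrite !subv_add sUFP -!memvE UPB ?lift_in // andbT /=.
  rewrite -[up](addKr (lift l1)) addrC UPB ?lift_in // -[up]scale1r.
  exact: up_in.
- apply/setP => l; rewrite inE; apply/eqP/idP => [hl|/CE lC].
    apply/CE/eqP; rewrite -subr_eq0 -(mulrI_eq0 _ (mulfI (x := s^-1) _)) -?hE ?hl ?subrr //.
    by rewrite invr_eq0 gt_eqF.
  by apply/eqP; rewrite eq_sym -subr_eq0 hE lC subrr mulr0.
Qed.

Let aff_cst := affine_on_cst a.

Lemma spanning_neq0 C (l0 : L) : spanning (affine_on a) C -> exists l, l \in C.
Proof.
move=> sC; apply: contrapT => /forallNP C0.
have /eqP := sC (cst 1) (aff_cst 1) (fun l lC => False_ind _ (C0 l lC)) l0.
by rewrite oner_eq0.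
Qed.

(** The graph of [h] supports the polyhedron along [F]. This [F] is bounded, lying in the hull of
    the lifted points, and spanning shows that it has codimension one. *)
Lemma spanning_facet_cell (l0 : L) h : lower (affine_on a) w h ->
  spanning (affine_on a) (tight w h) -> facet_cell a w (tight w h).
Proof.
move=> [[y [c hE]] hw] sC; have [lc lcC] := spanning_neq0 l0 sC.
have fE l : pair_form (- y) 1 (lift l) = w l - h l + c.
  rewrite /pair_form /row_form /= mulr1 mulmxN mxE hE opprD addrA subrK.
  by rewrite addrC.
have lcf l : c <= pair_form (- y) 1 (lift l) by rewrite fE lerDr subr_ge0.
have CE l : l \in tight w h <-> pair_form (- y) 1 (lift l) = c.
  rewrite fE; split=> [/tightP ->|/eqP]; first by rewrite subrr add0r.
  by rewrite -subr_eq0 addrK subr_eq0 => /eqP wh; apply/tightP.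
pose F := [set p | P p /\ pair_form (- y) 1 p = c].
have FE : F = [set p | P p /\ forall q, P q -> pair_form (- y) 1 p <= pair_form (- y) 1 q].
  apply/seteqP; split => p [Pp pc]; split => //.
    by move=> q Pq; rewrite pc form_ge.
  apply/eqP; rewrite eq_le form_ge // andbT.
  by move/CE: lcC => <-; apply/pc/lift_in.
have FC l : F (lift l) <-> l \in tight w h.
  by rewrite CE; split=> [[]//|lC]; split => //; apply: lift_in.
have Flc : F (lift lc) by apply/FC.
have FP : F `<=` P by move=> p [].
have Fc p : F p -> pair_form (- y) 1 p = c by case.
have Fmin p : F p -> conv_hull [set lift l | l in [set l | pair_form (- y) 1 (lift l) = c]] p.
  by move=> [Pp pc]; apply: form_min.
exists F; split.
- split; first by split; [exists (lift lc)|exists (pair_form (- y) 1)].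
  pose f : {scalar ('rV[R]_d * R^o)%type} := pair_form (- y) 1.
  have [UF UFE] := aff_hull_coset Flc.
  have [UP UPE] := aff_hull_coset (lift_in lc).
  have UFin p : F p -> p - lift lc \in UF.
    by move=> /(@aff_hull_sub _ _ F); rewrite UFE.
  have UPin p : P p -> p - lift lc \in UP.
    by move=> /(@aff_hull_sub _ _ P); rewrite UPE.
  have sUFP : (UF <= UP)%VS.
    apply/subvP => v /(coset_add UFE)/(aff_hullS FP).
    by rewrite UPE /= addrC addKr.
  have upUP : up \in UP.
    have := UPin _ (up_in ler01 (lift_in lc)).
    by rewrite scale1r addrC addKr.
  have upUF : up \notin UF.
    apply/negP => upF; have := coset_eq0 (f := f) UFE Fc upF.
    by rewrite /f /= form_upE => /eqP; rewrite oner_eq0.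
  (* A form vanishing on [UF] and [up] restricts to an affine function constant on the tight set,
     hence on all labels, so it vanishes on [UP]. *)
  have UPF : UP = (UF + <[up]>)%VS.
    apply/eqP; rewrite eqEsubv subv_add sUFP -memvE upUP !andbT.
    apply/subvP => v vP; apply/negPn/negP => /scalar_separates[g g0].
    have [z [s gE]] := scalar_pair g; rewrite gE; apply/negP/negPn.
    have s0 : s = 0.
      apply: etrans (esym (form_upE z s)) _; rewrite -gE; apply: g0.
      exact: (subvP (addvSr _ _) _ (memv_line _)).
    pose k := pair_form z s (lift lc).
    have kC l : l \in tight w h -> (a l *m z) 0 0 - k = 0.
      move=> /FC/UFin lF; have : g (lift l - lift lc) = 0.
        by apply: g0; apply: (subvP (addvSl _ _)).
      by rewrite linearB !gE {1}/pair_form s0 mulr0 addr0 -s0.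
    have kA : affine_on a (fun l => (a l *m z) 0 0 - k) by exists z, (- k).
    have kL := sC _ kA kC.
    pose fz : {scalar ('rV[R]_d * R^o)%type} := pair_form z s.
    have fzE p : fz p = (p.1 *m z) 0 0 by rewrite /fz /= /pair_form s0 mulr0 addr0.
    have kP p : P p -> fz p = k.
      move=> [q qc [p1 _]]; rewrite fzE p1 -fzE; apply: conv_hull_eq qc.
      by move=> _ [l _ <-]; rewrite fzE; apply/eqP; rewrite -subr_eq0; apply/eqP/kL.
    apply/eqP; exact: (coset_eq0 (f := fz) UPE kP vP).
  exists (\dim UF); split; last by exists (lift lc), UF.
  exists (lift lc), UP; split => //; rewrite UPF.
  rewrite dimv_disjoint_sum ?dim_vline.
    by rewrite /up xpair_eqE negb_and oner_eq0 orbT addn1.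
  apply/eqP; rewrite -subv0; apply/subvP => v; rewrite memv_cap => /andP[vF /vlineP[t vE]].
  have [t0|t0] := eqVneq t 0; first by rewrite vE t0 scale0r mem0v.
  by case/negP: upUF; rewrite -[up](scalerK t0) -vE memvZ.
- exists (\sum_l `|lift l|); split; first exact: num_real.
  move=> M lM p /Fmin [N [q [t [qS t0 t1 ->]]]]; apply: (le_trans (ler_norm_sum _ _ _)).
  rewrite -[M]mul1r -t1 mulr_suml; apply: ler_sum => i _.
  rewrite normrZ ger0_norm // ler_wpM2l // (le_trans _ (ltW lM)) //.
  by have [l _ <-] := qS i; rewrite (bigD1 l) //= lerDl sumr_ge0.
- by move=> l; rewrite FC.
Qed.

End FacetCells.

(** * Secondary cones as refinement cones, and the fan axioms *)

Section SecondaryFan.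
Variables (R : realType) (d : nat) (L : finType) (a : L -> 'rV[R]_d) (l0 : L).
Implicit Types (C D : {set L}) (w v x g h : L -> R^o).

Let Aff := affine_on a.
Let affP := @affine_onP R d L a.
Let aff_cst := @affine_on_cst R d L a.

Lemma facet_cellP w C : facet_cell a w C <->
  exists h, [/\ lower Aff w h, spanning Aff C & tight w h = C].
Proof.
split; first exact: facet_cell_spanning.
by move=> [h [lh sC tC]]; rewrite -tC in sC *; apply: spanning_facet_cell.
Qed.

(** A face of a maximal cell becomes a tight set after tilting [h] slightly by the form defining the
    face. Conversely, a tight set is the face of a larger spanning one cut out by the difference of
    the two affine functions. *)
Lemma regular_subdivisionP w D : regular_subdivision a w D <->
  D != finset.set0 /\ exists2 h, lower Aff w h & tight w h = D.
Proof.
split=> [[C [F [/facet_cellP[h [[ah hw] sC tC]] [[x0 Fx0] [f FE]] DF]]]|].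
  have [y fE] := scalar_row f.
  have Fx0' := Fx0; rewrite FE in Fx0'; case: Fx0' => x0C x0min.
  pose g : L -> R^o := fun l => (a l *m y) 0 0 + - f x0.
  have ag : Aff g by exists y, (- f x0).
  have inC l : l \in C -> conv_hull (a @` [set` C]) (a l).
    by move=> lC; apply: conv_hull_sub; exists l.
  have g0 l : l \in C -> 0 <= g l.
    by move=> /inC/x0min; rewrite [f (a l)]fE /g subr_ge0.
  have DE l : l \in D <-> l \in C /\ g l = 0.
    rewrite DF FE; split=> [[lC [_ lmin]]|[lC gl]]; split => //.
      apply/eqP; rewrite eq_le g0 // andbT /g subr_le0.
      by have := lmin _ x0C; rewrite [f (a l)]fE.
    have fl : f (a l) = f x0.
      by rewrite [LHS]fE; apply/eqP; rewrite -subr_eq0 -/(g l) gl.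
    by split; [exact: inC|move=> z zC; rewrite fl x0min].
  split.
    apply/finset.set0Pn.
    have x0C' : conv_hull [set z | (a @` [set` C]) z /\ f z = f x0] x0.
      by apply: conv_hull_min => // _ [l lC <-]; apply/x0min/inC.
    have [[|N] [p [t [pS _ t1 _]]]] := x0C'.
      by move: t1; rewrite big_ord0 => /eqP; rewrite eq_sym oner_eq0.
    have [[l lC lp] fp] := pS ord0; exists l; apply/DE; split => //.
    by rewrite /g -/(row_form y (a l)) -fE lp fp subrr.
  have [|l /eqP|e e0 eP] := @small_step R L (fun l => w l - h l) (fun l => - g l).
  - by move=> l; rewrite subr_ge0.
  - rewrite subr_eq0 => /eqP wh; rewrite oppr_le0 g0 // -tC.
    exact/tightP.
  (* Half the admissible step keeps the slack strictly positive off [C]. *)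
  pose h' : L -> R^o := (- (e / 2)) *: g + h.
  have hE l : w l - h' l = w l - h l + e / 2 * g l.
    by rewrite [h' l]/(- (e / 2) * g l + h l) opprD mulNr opprK addrCA addrC -addrA.
  have half l : l \notin C -> 0 < w l - h' l.
    move=> lC; rewrite hE; have s0 : 0 < w l - h l.
      rewrite lt0r subr_ge0 hw andbT subr_eq0; apply: contra lC => /eqP wh.
      by rewrite -tC; apply/tightP.
    rewrite -[X in _ + X]opprK subr_gt0 -mulrN.
    have [g1|g1] := leP (- g l) 0.
      by apply: le_lt_trans s0; rewrite mulr_ge0_le0 // divr_ge0 // ltW.
    apply: lt_le_trans (eP l); rewrite ltr_pM2r // ltr_pdivrMr //.
    by rewrite ltr_pMr // ltr1n.
  have onC l : l \in C -> w l - h' l = e / 2 * g l.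
    by rewrite hE -tC => /tightP ->; rewrite subrr add0r.
  exists h'.
    split; first exact: affP.
    move=> l; rewrite -subr_ge0; have [lC|lC] := boolP (l \in C).
      by rewrite onC // mulr_ge0 ?g0 // divr_ge0 // ltW.
    exact/ltW/half.
  apply/setP => l; rewrite inE; apply/eqP/idP => [hl|/DE[lC gl]].
    apply/DE; have [lC|lC] := boolP (l \in C).
      split => //; have := onC _ lC; rewrite hl subrr => /esym/eqP.
      by rewrite mulf_eq0 gt_eqF ?divr_gt0 //= => /eqP.
    by have := half _ lC; rewrite hl subrr ltxx.
  by apply/eqP; rewrite eq_sym -subr_eq0 onC // gl mulr0.
move=> [D0 [h' lh' tD]].
have [h [lh sub sC]] := lower_spanning affP aff_cst lh'.
case: (lh) => -[y [c hE]] hw; case: (lh') => -[y' [c' hE']] hw'.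
(* On the tight set of [h] this form equals the slack of [h'] up to a constant, so it is minimal
   exactly on [D]. *)
pose z := y - y'.
have zE l : l \in tight w h -> row_form z (a l) = (w l - h' l) + (c' - c).
  move/tightP => <-; rewrite /row_form mulmxBr mxE [X in _ + X]mxE hE hE'.
  by rewrite opprD [X in _ = X + _]addrACA -[c' - c]opprB addrK.
have [l1 l1D] : exists l, l \in D by apply/finset.set0Pn.
have l1C : l1 \in tight w h by apply: (fintype.subsetP sub); rewrite tD.
have wD l : l \in D -> w l - h' l = 0 by rewrite -tD => /tightP ->; rewrite subrr.
pose F := [set x | conv_hull (a @` [set` tight w h]) x /\
  forall q, conv_hull (a @` [set` tight w h]) q -> row_form z x <= row_form z q].
have min q : conv_hull (a @` [set` tight w h]) q -> c' - c <= row_form z q.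
  apply: conv_hull_ge => _ [l lC <-]; rewrite /= zE // lerDr subr_ge0; exact: hw'.
have FD l : l \in D <-> l \in tight w h /\ F (a l).
  have inC k : k \in tight w h -> conv_hull (a @` [set` tight w h]) (a k).
    by move=> kC; apply: conv_hull_sub; exists k.
  split=> [lD|[lC [_ Fl]]].
    have lC : l \in tight w h by apply: (fintype.subsetP sub); rewrite tD.
    split => //; split; first exact: inC.
    by move=> q /min; rewrite zE // wD // add0r.
  have := Fl _ (inC _ l1C); rewrite !zE // (wD _ l1D) lerD2r subr_le0 => wl.
  by rewrite -tD; apply/tightP/eqP; rewrite eq_le wl hw'.
exists (tight w h), F; split.
- by apply/facet_cellP; exists h.
- split; first by exists (a l1); have [] := (FD l1).1 l1D.
  by exists (row_form z).
- by move=> l; rewrite FD.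
Qed.

Lemma spanning_maximal_cell w h : lower Aff w h -> spanning Aff (tight w h) ->
  maximal_cell (regular_subdivision a w) (tight w h).
Proof.
move=> lh sC; split.
  apply/regular_subdivisionP; split; last by exists h.
  by have [l lC] := spanning_neq0 l0 sC; apply/finset.set0Pn; exists l.
move=> D /regular_subdivisionP[_ [h' lh' <-]] sub.
by rewrite (spanning_maximal affP lh lh' sC sub).
Qed.

(** Passing from [w] to [v] and back enlarges the tight set, but a spanning one is already maximal,
    so all inclusions are equalities. *)
Lemma refines_facet_cell w v C : refines Aff w v -> refines Aff v w ->
  facet_cell a w C -> facet_cell a v C.
Proof.
move=> wv vw /facet_cellP[h [lh sC tC]].
have [hv lv s1] := wv _ lh; have [hv' [lv' s2 sC']] := lower_spanning affP aff_cst lv.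
have [hw lw s3] := vw _ lv'; apply/facet_cellP; exists hv'.
have s12 := fintype.subset_trans s1 s2.
have hE : hw = h.
  apply: (spanning_maximal affP lh) => //; first by rewrite tC.
  exact: fintype.subset_trans s12 s3.
have tE : tight v hv' = C.
  by apply/eqP; rewrite finset.eqEsubset -tC s12 andbT -hE.
by split => //; rewrite -tE.
Qed.

Lemma regular_subdivision_eq w v :
  regular_subdivision a v = regular_subdivision a w <->
  refines Aff w v /\ refines Aff v w.
Proof.
have sub x y : regular_subdivision a x = regular_subdivision a y -> refines Aff x y.
  move=> E h lh; have [h0|h0] := eqVneq (tight x h) finset.set0.
    by have [h' lh'] := lower_exists aff_cst y; exists h' => //; rewrite h0 finset.sub0set.
  have : regular_subdivision a x (tight x h).
    by apply/regular_subdivisionP; split => //; exists h.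
  by rewrite E => /regular_subdivisionP[_ [h' lh' tE]]; exists h' => //; rewrite tE.
split=> [E|[wv vw]]; first by split; apply: sub.
apply/seteqP; split => D [C [F [fC fF DE]]]; exists C, F; split => //.
  exact: refines_facet_cell fC.
exact: refines_facet_cell fC.
Qed.

Let sigma w := [set x | refines Aff w x].

Let sigma_polyhedral w : polyhedral_cone (sigma w).
Proof. exact: refines_polyhedral. Qed.

Let sigma_interior w : interior_point (sigma w) w.
Proof.
by split=> [|y]; [exact: refines_refl|exact: (refines_sub affP aff_cst)].
Qed.

(** Here [v] is the sum of [e x] and [v - e x], both refined by [w], so it refines the first summand
    and hence [x]. *)
Let refines_of_sub w v (e : R) x : 0 < e ->
  sigma w x -> sigma w (v - e *: x) -> refines Aff v x.
Proof.
move=> e0 wx wvx.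
have := refines_addl affP aff_cst (refinesZ affP aff_cst (ltW e0) wx) wvx.
rewrite addrC subrK => /(refinesZ affP aff_cst (t := e^-1)).
by rewrite invr_ge0 ltW // scalerA mulVf ?gt_eqF // scale1r => /(_ isT).
Qed.

Lemma same_subdivisionE w :
  [set x | regular_subdivision a x = regular_subdivision a w] =
  [set x | sigma w x /\ exists2 e : R, 0 < e & sigma w (x - e *: w)].
Proof.
apply/seteqP; split => x /=.
  move=> /regular_subdivision_eq[wx xw]; split => //.
  have [e e0 xe] := refines_sub affP aff_cst xw.
  by exists e => //; apply: refines_trans xe.
move=> [wx [e e0 we]]; apply/regular_subdivision_eq; split => //.
by apply: refines_of_sub e0 _ we; apply: refines_refl.
Qed.

Lemma secondary_coneE w : secondary_cone a w = [set x | refines Aff w x].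
Proof.
by rewrite /secondary_cone same_subdivisionE polyhedral_closure.
Qed.

Lemma relint_secondary_cone w : relint (secondary_cone a w) =
  [set x | regular_subdivision a x = regular_subdivision a w].
Proof.
rewrite secondary_coneE same_subdivisionE -/(sigma w).
exact: (polyhedral_relint (sigma_polyhedral w) (sigma_interior w)).
Qed.

Lemma cone_subdivision_secondary w Delta :
  cone_subdivision a (secondary_cone a w) Delta <-> Delta = regular_subdivision a w.
Proof.
rewrite /cone_subdivision relint_secondary_cone; split=> [[_ /(_ w)] <-//|->].
by split; first by exists w.
Qed.

(** The smallest face of [sigma w] containing [v] is [sigma v]. *)
Lemma refines_face w v : refines Aff w v -> face (sigma w) (sigma v).
Proof.
move=> wv; have := polyhedral_face (sigma_polyhedral w) wv.
congr face; apply/seteqP; split => x /=.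
  by move=> [wx [e e0 we]]; apply: refines_of_sub e0 wx we.
move=> vx; split; first exact: refines_trans vx.
have [e e0 ve] := refines_sub affP aff_cst vx.
by exists e => //; apply: refines_trans ve.
Qed.

(** Any generic point [v] of the face serves. *)
Lemma face_refines w F : face (sigma w) F -> exists2 v, refines Aff w v & F = sigma v.
Proof.
move=> fF; have [f f0 FE] := face_cone (sigma_polyhedral w) fF.
have [||x y|v] := cone_generic_point (sigma_polyhedral w) (Q := F).
- by rewrite FE => x [].
- by case: fF.
- rewrite FE => -[wx fx] [wy fy]; split; last by rewrite linearD fx fy addr0.
  exact: (refinesD affP).
rewrite {1}FE => -[wv fv] vP; exists v => //; apply/seteqP; split => x.
  move=> Fx; have [e e0 we] := vP _ Fx; apply: refines_of_sub e0 _ we.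
  by move: Fx; rewrite FE => -[].
move=> vx; rewrite FE; have wx : sigma w x by apply: refines_trans vx.
split => //; have [e e0 ve] := refines_sub affP aff_cst vx.
have := f0 _ (refines_trans wv ve); rewrite linearB linearZ /= fv sub0r oppr_ge0.
by rewrite pmulr_rle0 // => fx; apply/eqP; rewrite eq_le fx f0.
Qed.

(** A generic point of the intersection, which contains 0, serves as [v]. *)
Lemma setI_refines w w' : exists v,
  [/\ refines Aff w v, refines Aff w' v & sigma w `&` sigma w' = sigma v].
Proof.
have [||x y|v [wv w'v] vP] :=
    cone_generic_point (sigma_polyhedral w) (Q := sigma w `&` sigma w').
- by move=> x [].
- by exists 0; split; apply: refines0.
- by move=> [wx w'x] [wy w'y]; split; apply: (refinesD affP).
exists v; split => //; apply/seteqP; split => x.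
  move=> Ix; have [e e0 we] := vP _ Ix.
  by apply: refines_of_sub e0 _ we; case: Ix.
by move=> vx; split; apply: refines_trans vx.
Qed.

(** A secondary cone depends only on the subdivision, one of finitely many sets of cells. *)
Lemma secondary_fan_finite : finite_set (secondary_fan a).
Proof.
pose G (S : {set {set L}}) := closure [set w | regular_subdivision a w = [set` S]].
apply: (@sub_finite_set _ _ (G @` setT)); last exact/finite_image/finite_finset.
move=> _ [w _ <-]; exists (finset (fun D => `[< regular_subdivision a w D >])) => //.
rewrite /G /secondary_cone; congr closure; apply/seteqP; split => x /= ->;
  by apply/seteqP; split => D /=; rewrite inE => /asboolP.
Qed.

Lemma secondary_subfan (Phi : set (L -> R^o)) :
  (forall w v, refines Aff w v -> Phi w -> Phi v) -> fan (secondary_cone a @` Phi).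
Proof.
move=> Phi_mono; split.
- apply: sub_finite_set secondary_fan_finite.
  by move=> _ [w _ <-]; exists w.
- by move=> _ [w _ <-]; rewrite secondary_coneE; apply: sigma_polyhedral.
- move=> _ F [w Pw <-]; rewrite secondary_coneE => /face_refines[v wv ->].
  by exists v; [exact: Phi_mono Pw|rewrite secondary_coneE].
- move=> _ _ [w _ <-] [w' _ <-]; rewrite !secondary_coneE.
  by have [v [wv w'v ->]] := setI_refines w w'; split; apply: refines_face.
Qed.

End SecondaryFan.

(** * The tropical resultant and fully mixed cells through the Cayley configuration *)

Section TropicalResultantFan.
Variables (R : realType) (k n : nat) (m : 'I_k -> nat).
Variable A : forall i : 'I_k, 'I_(m i) -> 'rV[int]_n.
Arguments A : clear implicits.
Implicit Types (c h w v : label m -> R^o) (C D : {set label m}).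

Let lab (i : 'I_k) (j : 'I_(m i)) : label m := Tagged (fun i => 'I_(m i)) j.

Definition fiber C (i : 'I_k) : {set 'I_(m i)} := finset (fun j => lab j \in C).

(** Any tight set is allowed, not only a spanning one, so the condition passes directly to refined
    weights. *)
Definition fully_mixed_weight c := exists2 h,
  lower (affine_on (cayley A R)) c h & forall i, (2 <= #|fiber (tight c h) i|)%N.

Lemma fiberS C D i : C \subset D -> fiber C i \subset fiber D i.
Proof. by move=> /fintype.subsetP CD; apply/fintype.subsetP => j; rewrite !inE => /CD. Qed.

Lemma cayley_cell_fiber C : cayley_cell (fiber C) = C.
Proof. by apply/setP => -[i j]; rewrite !inE. Qed.

Lemma fully_mixed_weight_refines w v : refines (affine_on (cayley A R)) w v ->
  fully_mixed_weight w -> fully_mixed_weight v.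
Proof.
move=> wv [h lh card_h]; have [h' lh' sub] := wv _ lh; exists h' => // i.
exact: leq_trans (card_h i) (subset_leq_card (fiberS i sub)).
Qed.

Lemma cayley_mul (y : 'cV[R]_(k + n)) i (j : 'I_(m i)) :
  (cayley A R (lab j) *m y) 0 0 =
  usubmx y i 0 + \sum_(s < n) (A i j 0 s)%:~R * dsubmx y s 0.
Proof.
rewrite -{1}[y]vsubmxK /cayley /cayley_int map_row_mx mul_row_col mxE.
rewrite map_delta_mx -rowE [X in X + _]mxE; congr (_ + _).
by rewrite mxE; apply: eq_bigr => s _; rewrite mxE.
Qed.

(** A point [x] corresponds to the affine function with linear part [- x] on the last [n]
    coordinates and the minima of the polynomials as the first [k] coefficients. Its slack at a
    label is the term minus the minimum. *)
Lemma tropical_resultantE c : tropical_resultant R A c <-> fully_mixed_weight c.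
Proof.
split=> [[x xT]|[h [[y [e hE]] hc] card_h]].
  pose t i j := trop_term (A i) (fun j => c (lab j)) x j.
  have j1_ex i : {j1 : 'I_(m i) | exists j2, j1 != j2 /\
      forall j, t i j1 <= t i j /\ t i j2 <= t i j}.
    by apply: cid; have [j1 [j2 ?]] := xT i I; exists j1, j2.
  pose j1 i := sval (j1_ex i); have j1P i := svalP (j1_ex i).
  pose y : 'cV[R]_(k + n) := col_mx (\col_i t i (j1 i)) (- x^T).
  have yE i (j : 'I_(m i)) : (cayley A R (lab j) *m y) 0 0 = t i (j1 i) - (t i j - c (lab j)).
    rewrite cayley_mul col_mxKu col_mxKd mxE; congr (_ + _).
    rewrite /t /trop_term addrC addKr -sumrN; apply: eq_bigr => s _.
    by rewrite !mxE mulrN.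
  exists (fun l => (cayley A R l *m y) 0 0).
    split; first by exists y, 0 => l; rewrite addr0.
    move=> [i j]; rewrite (yE i j) opprB addrCA gerDl subr_le0.
    by have [j2 [_ /(_ j)[]]] := j1P i.
  move=> i; apply/card_gt1P; have [j2 [j12 jP]] := j1P i.
  exists (j1 i), j2; split => //; rewrite inE; apply/tightP; rewrite yE opprB addrCA.
    by rewrite subrr addr0.
  have -> : t i j2 = t i (j1 i).
    by apply/le_anti; rewrite (jP (j1 i)).2 (jP j2).1.
  by rewrite subrr addr0.
exists (- (dsubmx y)^T) => i _.
(* Each term is the slack of [h] plus a constant depending only on [i], so tight labels attain the
   minimum. *)
have tE (j : 'I_(m i)) : trop_term (A i) (fun j => c (lab j)) (- (dsubmx y)^T) j
    = c (lab j) - h (lab j) + (usubmx y i 0 + e).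
  rewrite hE cayley_mul /trop_term -addrA; congr (_ + _).
  rewrite addrAC opprD addrAC addNr add0r -sumrN.
  by apply: eq_bigr => s _; rewrite !mxE mulrN.
have /card_gt1P[j1 [j2 []]] := card_h i.
rewrite !inE => /eqP t1 /eqP t2 j12; exists j1, j2; split => // j.
by rewrite !tE t1 t2 !subrr add0r lerDr subr_ge0; split; apply: hc.
Qed.

(** Enlarging a tight set to a spanning one gives a maximal cell and can only enlarge the fibers.
    Conversely, the factors of a fully mixed cell lie in the fibers of a tight set. *)
Lemma mixed_subdivisionE (l0 : label m) c : fully_mixed_weight c <->
  exists2 P, mixed_subdivision (regular_subdivision (cayley A R) c) P & fully_mixed P.
Proof.
split=> [[h lh card_h]|[_ [J0 -> [/(regular_subdivisionP _ l0)[_ [h lh tE]] _]] [J JE card_J]]].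
  have [h1 [lh1 sub sp]] := lower_spanning (@affine_onP _ _ _ _) (@affine_on_cst _ _ _ _) lh.
  exists (mixed_cell (fiber (tight c h1))).
    exists (fiber (tight c h1)) => //; rewrite cayley_cell_fiber.
    exact: spanning_maximal_cell.
  exists (fiber (tight c h1)) => // i.
  exact: leq_trans (card_h i) (subset_leq_card (fiberS i sub)).
exists h => // i; apply: leq_trans (card_J i) (subset_leq_card _).
have -> : fiber (tight c h) i = J0 i by apply/setP => j; rewrite tE !inE.
(* The families [J] and [J0] are only known to have equal products. Elements of the other nonempty
   factors complete [j] to a point of the product, which shows that [j] lies in [J0 i]. *)
have f i' : {j | j \in J i'}.
  by apply: cid; apply/finset.set0Pn; rewrite -card_gt0 ltnW.
apply/fintype.subsetP => j jJ.
have : (finfun (eqtype.dfwith (fun i' => sval (f i')) j) : mixed_label m) \in mixed_cell J0.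
  rewrite JE; apply/setXnP => i'; rewrite ffunE.
  by case: eqtype.dfwithP => // i'' _; apply: (svalP (f i'')).
by move=> /setXnP/(_ i); rewrite ffunE eqtype.dfwith_in.
Qed.

Lemma fully_mixed_conesE (l0 : label m) : fully_mixed_cones R A =
  secondary_cone (cayley A R) @` [set c | fully_mixed_weight c].
Proof.
apply/seteqP; split => sigma.
  move=> [[w _ <-] [Delta /(cone_subdivision_secondary _ l0) -> mixD]].
  by exists w => //; apply/(mixed_subdivisionE l0).
move=> [w Pw <-]; split; first by exists w.
exists (regular_subdivision (cayley A R) w); last exact/mixed_subdivisionE.
exact/cone_subdivision_secondary.
Qed.

End TropicalResultantFan.

Theorem theorem2p16 (R : realType) (k n : nat) (m : 'I_k -> nat)
    (A : forall i : 'I_k, 'I_(m i) -> 'rV[int]_n)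
    (hk : (1 <= k)%N) (hm : forall i : 'I_k, (2 <= m i)%N) :
  subfan (fully_mixed_cones R A) (secondary_fan (cayley A R)) /\
  tropical_resultant R A = fan_support (fully_mixed_cones R A).
Proof.
(* A label exists, so the constant 1 is nonzero and spanning sets are nonempty. *)
have l0 : label m := Tagged (fun i => 'I_(m i)) (Ordinal (ltnW (hm (Ordinal hk)))).
split; first split.
- by move=> sigma [].
- rewrite fully_mixed_conesE //; apply: secondary_subfan => // w v.
  exact: fully_mixed_weight_refines.
rewrite fully_mixed_conesE //; apply/seteqP; split => c.
  move=> /tropical_resultantE Pc; exists (secondary_cone (cayley A R) c).
    by exists c.
  by rewrite secondary_coneE //; apply: refines_refl.
move=> [_ [w Pw <-]]; rewrite secondary_coneE // => wc.
exact/tropical_resultantE/(fully_mixed_weight_refines wc).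
Qed.
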